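(* Let $Y \subseteq \mathcal{LO}(M_1)$ be a minimal subflow of the $G$-flow $\mathcal{LO}(M_1)$, where $G=\mathrm{Aut}(M_1)$. Then every $G$-orbit on $Y$ is meagre in $Y$.
   Context: Graphs are simple and ''subgraph'' means induced subgraph. An orientation of a graph assigns a direction to each edge; it is a $2$-orientation if every vertex has out-degree at most $2$, and it is acyclic if there is no directed cycle. Let $\mathcal{D}_1$ be the class of finite acyclic $2$-oriented graphs and $\mathcal{C}_1$ the class of finite graphs admitting an acyclic $2$-orientation (equivalently, finite graphs in which every non-empty subgraph has a vertex of degree $\le 2$). For an oriented graph $A$, a subset $B\subseteq A$ is successor-closed if every out-neighbour in $A$ of a vertex of $B$ lies in $B$. For $A\subseteq B$ with $A,B\in\mathcal{C}_1$, write $A\le_1 B$ if there is an acyclic $2$-orientation of $B$ in which $A$ is successor-closed. $(\mathcal{C}_1,\le_1)$ is a free amalgamation class; its Fraïssé limit $M_1$ is the unique (up to isomorphism) countable graph which is the union of a chain $A_0\le_1 A_1\le_1\cdots$ of graphs in $\mathcal{C}_1$ (for finite $A\subseteq M_1$ one writes $A\le_1 M_1$ if $A\le_1 A_n$ for some $n$ with $A\subseteq A_n$), such that every graph of $\mathcal{C}_1$ is isomorphic to some $A\le_1 M_1$ and every isomorphism between finite $A,A'\le_1 M_1$ extends to an automorphism of $M_1$. $\mathcal{LO}(M_1)$ is the space of all linear orders on the vertex set of $M_1$, with the topology of pointwise convergence (basic open sets prescribe the restriction of the order to a finite set), on which $G=\mathrm{Aut}(M_1)$ acts by $x\,(g\cdot\prec)\,y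 \iff g^{-1}x\prec g^{-1}y$. A subflow is a non-empty closed $G$-invariant subset; it is minimal if it contains no proper subflow. *)

(* Defs.v *)
From mathcomp Require Import all_boot finmap.
From mathcomp Require Import all_classical topology.

Set Implicit Arguments.
Unset Strict Implicit.
Unset Printing Implicit Defensive.

Local Open Scope classical_set_scope.

Record sgraph (V : Type) := SGraph {
  adj :> rel V;
  adj_sym : symmetric adj;
  adj_irr : irreflexive adj }.

Definition induced (V : choiceType) (G : sgraph V) (A : {fset V}) : sgraph A :=
  @SGraph A (fun x y => G (val x) (val y))
    (fun x y => adj_sym G (val x) (val y)) (fun x => adj_irr G (val x)).

Definition graph_iso (V W : Type) (G : sgraph V) (H : sgraph W) (f : V -> W) :=
  bijective f /\ forall x y, H (f x) (f y) = G x y.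

Definition orientation (V : Type) (G : sgraph V) (o : rel V) :=
  forall x y, (G x y = o x y || o y x) /\ ~~ (o x y && o y x).

(* Since [orientation] excludes loops and 2-cycles, a non-empty [ucycle] of
   an orientation is a directed cycle in the usual sense. *)
Definition acyclic (T : eqType) (o : rel T) :=
  forall c : seq T, ucycle o c -> c = [::].

Definition acyclic_2orientation (T : finType) (G : sgraph T) (o : rel T) :=
  [/\ orientation G o,
      forall x, #|[pred y | o x y]| <= 2 &
      acyclic o].

Definition C1 (T : finType) (G : sgraph T) :=
  exists o : rel T, acyclic_2orientation G o.

Definition successor_closed (T : Type) (o : rel T) (B : pred T) :=
  forall x y, B x -> o x y -> B y.

(* The induced graphs on A and B are then both in C1: restrict the
   orientation. *)
Definition le1 (V : choiceType) (G : sgraph V) (A B : {fset V}) :=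
  (A `<=` B)%fset /\
  exists o : rel B,
    acyclic_2orientation (induced G B) o /\
    successor_closed o [pred x | val x \in A].

Definition le1_chain (V : choiceType) (G : sgraph V) (F : nat -> {fset V})
    (A : {fset V}) :=
  exists n, (A `<=` F n)%fset /\ le1 G A (F n).

Record aut (V : Type) (G : sgraph V) := Aut {
  aut_fun :> V -> V;
  aut_inv : V -> V;
  aut_funK : cancel aut_fun aut_inv;
  aut_invK : cancel aut_inv aut_fun;
  aut_adj : forall x y, G (aut_fun x) (aut_fun y) = G x y }.

Definition fraisse_limit_C1 (V : countType) (M : sgraph V) :=
  exists F : nat -> {fset V},
    [/\ forall n, le1 M (F n) (F n.+1),
        forall x, exists n, x \in F n,
        (forall (T : finType) (H : sgraph T), C1 H ->
           exists A : {fset V}, le1_chain M F A /\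
           exists f : T -> A, graph_iso H (induced M A) f) &
        (forall A A' : {fset V}, le1_chain M F A -> le1_chain M F A' ->
           forall f : A -> A', graph_iso (induced M A) (induced M A') f ->
           exists g : aut M, forall x : A, g (val x) = val (f x))].

(* Strict linear orders. Used as a type, this set carries the library's
   subspace topology, here that of pointwise convergence ([bool] is
   discrete). *)
Definition LO (V : Type) : set {ptws (V * V) -> bool} :=
  [set r | [/\ forall x, ~~ r (x, x),
               forall x y z, r (x, y) -> r (y, z) -> r (x, z) &
               forall x y, x <> y -> r (x, y) \/ r (y, x)]].
Arguments LO : clear implicits.

Definition translate (V : Type) (G : sgraph V) (g : aut G)
    (r : {ptws (V * V) -> bool}) : {ptws (V * V) -> bool} :=
  fun p => r (aut_inv g p.1, aut_inv g p.2).

Lemma translate_LO (V : Type) (G : sgraph V) (g : aut G) (r : LO V) :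
  translate g (set_val r) \in LO V.
Proof.
have [irr tr tot] := set_valP r; apply/mem_set; split=> [x|x y z|x y xy].
- exact: irr.
- exact: tr.
- by apply: tot => e; apply: xy; rewrite -(aut_invK g x) e aut_invK.
Qed.

Definition act (V : Type) (G : sgraph V) (g : aut G) (r : LO V) : LO V :=
  exist _ (translate g (set_val r)) (translate_LO g r).

Definition flow_orbit (V : Type) (G : sgraph V) (r : LO V) : set (LO V) :=
  [set act g r | g in [set: aut G]].

Definition subflow (V : Type) (G : sgraph V) (Y : set (LO V)) :=
  [/\ Y !=set0, closed Y & forall (g : aut G) r, Y r -> Y (act g r)].

Definition minimal_subflow (V : Type) (G : sgraph V) (Y : set (LO V)) :=
  subflow G Y /\ forall Z, subflow G Z -> Z `<=` Y -> Z = Y.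

Definition nowhere_dense (T : topologicalType) (A : set T) :=
  (closure A)° = set0.

Definition meagre (T : topologicalType) (A : set T) :=
  exists2 F : nat -> set T,
    forall n, nowhere_dense (F n) & A `<=` \bigcup_n F n.

(* Main.v *)
Require Import Defs.
From mathcomp Require Import all_boot finmap.
From mathcomp Require Import all_classical topology.
From mathcomp Require Import zify.
From mathcomp Require Import seq.

Set Implicit Arguments.
Unset Strict Implicit.
Unset Printing Implicit Defensive.

Local Open Scope classical_set_scope.

(* Call an order [y] and an acyclic 2-orientation compatible if, for distinct
   [s], [z], [z'], the set of common in-neighbours of [s] and [z] does not cross,
   in the circular sense, the set of common in-neighbours of [s] and [z'].
   Adding the common in-neighbours of a pair all at once, and choosing them in
   a single cut of what is already there, produces compatible orientations;
   minimality of [Y] then gives every [y] in [Y] a compatible orientation of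
   every finite set.

   Conversely [y] reveals edges. Suppose that [s] has two forced out-edges,
   that [t -> e1] and [t -> e2], where [e1] and [e2] are in-neighbours of [s]
   separated by many in-neighbours of [s] and [z], and that many [f] are
   in-neighbours of [s] and [t]. The [f]'s cannot be close to both [e1] and
   [e2], so in every orientation compatible with [y] one of the edges
   [t -> e1], [t -> e2] is present. Continuing along the other edge gives
   arbitrarily long chains in which every vertex has a revealed out-edge. A
   finite set [C] attached on top of such a chain, one edge for each unit of
   [2 |C| - |E(C)|], has no room left for a sink: in every compatible
   orientation each vertex of [C] reaches [s] within a number of steps that
   depends on [C] only, while the self-sufficient closure of [s] can be taken
   arbitrarily large.

   If the orbit of [r] were not meagre, some [G_a r] would be dense in a
   non-empty open subset of [Y]. By minimality this open set contains orders
   of the above kind with [a] in [C], so in an orientation compatible with [r]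
   the vertex [a] would reach infinitely many vertices within a bounded number
   of steps, which is absurd as out-degrees are at most 2. *)

(** * Finite graphs as construction sequences *)

Section SeqFacts.
Variable V : eqType.
Implicit Types (w u s : seq V) (p : pred V).

Lemma count_eq_mem p w w' : uniq w -> uniq w' -> w =i w' ->
  count p w = count p w'.
Proof. by move=> uw uw' e; apply/permP/uniq_perm. Qed.

Lemma count_subset p w w' : uniq w -> {subset w <= w'} ->
  count p w <= count p w'.
Proof.
move=> uw sw; rewrite -!size_filter; apply: uniq_leq_size.
  exact: filter_uniq.
by move=> x; rewrite !mem_filter => /andP[-> /sw].
Qed.

Lemma index_filter p w x z : p x -> p z ->
  (index x (filter p w) < index z (filter p w)) = (index x w < index z w).
Proof.
move=> px pz; elim: w => //= a w IH.
case: (boolP (p a)) => pa /=; first by case: eqP => _; case: eqP => _.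
case: eqP => [e|_]; first by rewrite e px in pa.
case: eqP => [e|_]; first by rewrite e pz in pa.
exact: IH.
Qed.

Lemma sum_count_pred1 w x : uniq w -> x \in w ->
  \sum_(a <- w) (a == x : nat) = 1.
Proof.
move=> uw xw; rewrite -big_mkcond /= sum1_count.
by rewrite (count_uniq_mem x uw) xw.
Qed.

End SeqFacts.

Section Good.
Variables (V : eqType) (M : sgraph V).
Implicit Types (w u s : seq V) (x z : V) (p : pred V).

Local Notation msym := (adj_sym M).
Local Notation mirr := (adj_irr M).

(* Later vertices come first in the list: an edge points from its earlier
   entry to its later one. *)
Fixpoint good w : bool :=
  if w is x :: w' then [&& x \notin w', count (M x) w' <= 2 & good w'] else true.

Fixpoint edges w : nat :=
  if w is x :: w' then count (M x) w' + edges w' else 0.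

(** The orientation carried by [w]. Since [index] sends absent vertices to [size w], membership of
    [z] has to be demanded, while that of [x] follows. *)
Definition lo w x z := [&& M x z, index x w < index z w & z \in w].

Lemma adj_neq x z : M x z -> x != z.
Proof. by apply: contraTneq => ->; rewrite mirr. Qed.

Lemma good_uniq w : good w -> uniq w.
Proof. by elim: w => //= x w IH /and3P[-> _ /IH]. Qed.

Lemma good_suffix u w : good (u ++ w) -> good w.
Proof. by elim: u => //= x u IH /and3P[_ _ /IH]. Qed.

(** The count at an entry of [u] depends only on the set of entries behind it. *)
Lemma good_replace u w w' : good (u ++ w) -> good w' -> w =i w' ->
  good (u ++ w').
Proof.
move=> + gw' e; elim: u => //= x u IH /and3P[xn cx g].
rewrite IH // andbT.
have gu := IH g.
rewrite !mem_cat -e -mem_cat xn /=.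
rewrite (@count_eq_mem _ _ _ (u ++ w)) //; first exact: good_uniq.
  exact: good_uniq.
by move=> a; rewrite !mem_cat e.
Qed.

Lemma good_filter p w : good w -> good (filter p w).
Proof.
elim: w => //= x w IH /and3P[xn cx g]; case: (p x) => /=; last exact: IH.
rewrite IH // andbT mem_filter negb_and xn orbT /=.
apply: leq_trans cx; apply: count_subset.
  exact/filter_uniq/good_uniq.
by move=> a; rewrite mem_filter => /andP[].
Qed.

Lemma lo_adj w x z : lo w x z -> M x z. Proof. by case/and3P. Qed.
Lemma lo_memr w x z : lo w x z -> z \in w. Proof. by case/and3P. Qed.
Lemma lo_meml w x z : lo w x z -> x \in w.
Proof.
case/and3P=> _ i zw; rewrite -index_mem; apply: leq_trans i _.
by rewrite index_size.
Qed.
Lemma lo_asym w x z : lo w x z -> lo w z x = false.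
Proof.
move=> /and3P[_ i _]; apply/negP => /and3P[_ j _].
by have := ltn_trans i j; rewrite ltnn.
Qed.
Lemma lo_total w x z : x \in w -> z \in w -> M x z -> lo w x z || lo w z x.
Proof.
move=> xw zw m; rewrite /lo m (msym z x) m xw zw /= !andbT.
rewrite -neq_ltn; apply/negP => /eqP e.
have := adj_neq m; apply/negP; rewrite negbK; apply/eqP.
by rewrite -[x](@nth_index _ x _ w) // e nth_index.
Qed.

Lemma lo_filter p w x z : p x -> p z -> lo (filter p w) x z = lo w x z.
Proof. by move=> px pz; rewrite /lo index_filter // mem_filter pz. Qed.

Lemma lo_filter_sub p w x z : lo (filter p w) x z -> lo w x z.
Proof.
move=> l; have := lo_meml l; have := lo_memr l; rewrite !mem_filter.
by move=> /andP[pz _] /andP[px _]; rewrite lo_filter in l.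
Qed.

Lemma lo_catr u w x z : uniq (u ++ w) -> x \in w ->
  lo (u ++ w) x z = lo w x z.
Proof.
rewrite cat_uniq => /and3P[_ /hasPn d _] xw.
have xu := d x xw; rewrite /= in xu.
rewrite /lo !index_cat (negbTE xu) mem_cat.
case: (boolP (z \in u)) => zu /=; last by rewrite ltn_add2l.
rewrite (_ : _ < _ = false) ?andbF /=.
  by rewrite [z \in w](negbTE (contraL (@d z) zu)) !andbF.
apply/negbTE; rewrite -leqNgt; apply: leq_trans (leq_addr _ _).
by apply: ltnW; rewrite index_mem.
Qed.

Lemma lo_catlr u w x z : uniq (u ++ w) -> x \in u -> z \in w ->
  lo (u ++ w) x z = M x z.
Proof.
rewrite cat_uniq => /and3P[_ /hasPn d _] xu zw.
have zu := d z zw; rewrite /= in zu.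
rewrite /lo !index_cat xu (negbTE zu) mem_cat zw orbT andbT.
by rewrite ltn_addr ?andbT // index_mem.
Qed.

Lemma lo_catl u w x z : x \in u -> z \in u -> lo (u ++ w) x z = lo u x z.
Proof. by move=> xu zu; rewrite /lo !index_cat xu zu mem_cat zu. Qed.

Lemma lo_head x w z : x \notin w -> lo (x :: w) x z = M x z && (z \in w).
Proof.
move=> xw; rewrite /lo /= eqxx inE.
case: eqP => [<-|/eqP ne] /=; first by rewrite mirr.
by rewrite (eq_sym z) (negbTE ne).
Qed.

Lemma lo_tail x w a z : x \notin w -> a \in w -> lo (x :: w) a z = lo w a z.
Proof.
move=> xw aw; have ne : x != a by apply: contraNneq xw => ->.
rewrite /lo /= (negbTE ne) inE.
case: (x =P z) => [<-|/eqP nz] /=; last by rewrite ltnS (eq_sym z) (negbTE nz).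
by rewrite (negbTE xw) !andbF.
Qed.

Lemma count_lo_head x w : x \notin w ->
  count (lo (x :: w) x) (x :: w) = count (M x) w.
Proof.
move=> xw /=; rewrite lo_head // mirr /= add0n.
by apply: eq_in_count => a aw; rewrite lo_head // aw andbT.
Qed.

Lemma count_lo_tail x w a : x \notin w -> a \in w ->
  count (lo (x :: w) a) (x :: w) = count (lo w a) w.
Proof.
move=> xw aw /=.
have /negbTE -> : ~~ lo (x :: w) a x.
  by rewrite lo_tail //; apply: contra xw => /lo_memr.
by apply: eq_count => b; rewrite lo_tail.
Qed.

Lemma goodP w :
  reflect (uniq w /\ forall x, x \in w -> count (lo w x) w <= 2) (good w).
Proof.
apply: (iffP idP) => [g|].
  split; first exact: good_uniq.
  elim: w g => //= a w IH /and3P[an ca g] x; rewrite inE => /predU1P[->|xw].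
    by have /= -> := count_lo_head an.
  by have /= -> := count_lo_tail an xw; exact: IH.
elim: w => [|a w IH] [] //= /andP[an u] h; rewrite an /=; apply/andP; split.
  by have := h a (mem_head _ _); have /= -> := count_lo_head an.
apply: IH; split=> // x xw; have := h x; rewrite inE xw orbT => /(_ isT).
by have /= -> := count_lo_tail an xw.
Qed.

(** By [goodP], goodness bounds out-degrees, so it passes to every rearrangement that reverses no
    edge. *)
Lemma good_lo w w' : good w -> uniq w' -> w' =i w ->
  (forall x z, lo w' x z -> lo w x z) -> good w'.
Proof.
move=> /goodP[uw c] uw' e l; apply/goodP; split=> // x xw'.
rewrite e in xw'; apply: leq_trans (c x xw').
rewrite (@count_eq_mem _ _ w' w) //.
by apply: sub_count => z /l.
Qed.

Lemma good_le2 w x s : good w -> uniq s -> all (lo w x) s -> size s <= 2.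
Proof.
case: s => // a s g us h.
have xw : x \in w by move: h => /= /andP[/lo_meml].
have /goodP[_ /(_ x xw)] := g; apply: leq_trans.
rewrite -(count_predT (a :: s)).
rewrite (@eq_in_count _ predT (lo w x)); first by
  apply: count_subset => // b bs; apply: lo_memr (allP h b bs).
by move=> b bs; rewrite (allP h).
Qed.

Lemma edges_sum w : (edges w).*2 = \sum_(x <- w) count (M x) w.
Proof.
elim: w => [|x w IH]; first by rewrite big_nil.
rewrite /= big_cons /= mirr /= add0n big_split /= -IH.
rewrite (_ : \sum_(i <- w) M i x = count (M x) w); first by lia.
rewrite -big_mkcond sum1_count; apply: eq_count => a /=.
by rewrite msym.
Qed.

Lemma edges_perm w w' : perm_eq w w' -> edges w = edges w'.
Proof.
move=> pw; apply: double_inj; rewrite !edges_sum (perm_big _ pw) /=.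
by apply: eq_bigr => x _; apply/permP.
Qed.

Lemma edges_lo w : uniq w -> edges w = \sum_(x <- w) count (lo w x) w.
Proof.
elim: w => [|x w IH]; first by rewrite big_nil.
move=> /= /andP[xn uw]; rewrite big_cons.
have /= -> := count_lo_head xn; congr (_ + _); rewrite IH //.
rewrite !big_seq; apply: eq_bigr => a aw.
by have /= -> := count_lo_tail xn aw.
Qed.

(** The edges are counted by out-degrees: of an allowance of 2 each, an entry of [L] gives up one
    and the sink [m] both. *)
Lemma edges_bound w (L : seq V) m : good w ->
  (forall x, x \in w -> x \in L -> count (lo w x) w <= 1) ->
  m \in w -> m \notin L -> count (lo w m) w = 0 ->
  edges w + count (mem L) w + 2 <= 2 * size w.
Proof.
move=> /goodP[uw c2] cL mw mL m0.
have -> : 2 * size w = \sum_(x <- w) 2.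
  by rewrite big_const_seq count_predT iter_addn_0.
have -> : count (mem L) w = \sum_(x <- w) (x \in L : nat).
  by rewrite -sum1_count big_mkcond /=.
have e2 : \sum_(x <- w) 2 * (x == m) = 2.
  by rewrite -big_distrr /= sum_count_pred1.
rewrite -[X in _ + X <= _]e2.
rewrite edges_lo // -!big_split /= !big_seq; apply: leq_sum => x xw.
case: (x =P m) => [->|_]; first by rewrite m0 (negbTE mL).
have := c2 x xw; have := cL x xw; case: (x \in L) => [/(_ isT)|_]; lia.
Qed.

(** Reachability in at most [k] steps, with repetitions. In a good list a step adds at most two
    vertices per entry, whence the bound [3 ^ k]. *)
Fixpoint descents w v k : seq V :=
  if k is k'.+1
  then descents w v k' ++ flatten [seq filter (lo w x) w | x <- descents w v k']
  else [:: v].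

Lemma descents_mono w v k k' : k <= k' -> {subset descents w v k <= descents w v k'}.
Proof.
move=> /subnKC <-; elim: (k' - k) => [|d IH] x; first by rewrite addn0.
by move=> /IH xb; rewrite addnS /= mem_cat xb.
Qed.

Lemma descents_step w v k x z : x \in descents w v k -> lo w x z ->
  z \in descents w v k.+1.
Proof.
move=> xb l; rewrite /= mem_cat; apply/orP; right.
apply/flattenP; exists (filter (lo w x) w); first exact: map_f.
by rewrite mem_filter l (lo_memr l).
Qed.

Lemma descentsSP w v k z : z \in descents w v k.+1 ->
  z \in descents w v k \/ exists2 x, x \in descents w v k & lo w x z.
Proof.
rewrite /= mem_cat => /orP[|/flattenP[? /mapP[x xb ->]]]; first by left.
by rewrite mem_filter => /andP[l _]; right; exists x.
Qed.

Lemma size_descents w v k : good w -> size (descents w v k) <= 3 ^ k.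
Proof.
move=> g; elim: k => //= k IH; rewrite size_cat expnS.
suff : size (flatten [seq filter (lo w x) w | x <- descents w v k]) <=
   2 * size (descents w v k) by lia.
elim: (descents _ _ _) => //= x s IHs; rewrite size_cat mulnS leq_add //.
apply: (good_le2 g (x := x)); first exact/filter_uniq/good_uniq.
by rewrite filter_all.
Qed.

Lemma descents_filter p w v k : {subset descents (filter p w) v k <= descents w v k}.
Proof.
elim: k => // k IH x /descentsSP[/IH|[a /IH ab /lo_filter_sub l]].
  exact: descents_mono.
exact: descents_step ab l.
Qed.

(* Walking down inside [P], whose trace on [w] is exhausted after at most
   [size P] steps. *)
Lemma descents_sink w (P : seq V) v : uniq w -> uniq P -> v \in w -> v \in P ->
  exists2 m, m \in descents w v (size P) &
    m \in P /\ forall z, z \in P -> ~~ lo w m z.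
Proof.
move=> uw uP vw vP; set Q := filter (mem P) w.
have sQ : size Q <= size P.
  apply: uniq_leq_size; first exact: filter_uniq.
  by move=> x; rewrite mem_filter => /andP[].
suff: forall n k x, x \in descents w v k -> x \in P -> x \in w ->
    size Q - index x Q <= n ->
    exists2 m, m \in descents w v (k + n) & m \in P /\
      forall z, z \in P -> ~~ lo w m z.
  move=> /(_ (size P) 0 v); rewrite mem_head vP vw add0n; apply=> //.
  by apply: leq_trans sQ; rewrite leq_subr.
elim=> [|n IH] k x xb xP xw.
  have: x \in Q by rewrite mem_filter /= xP.
  by rewrite -index_mem; lia.
case: (boolP (has (lo w x) P)) => [/hasP[z zP l] h|/hasPn h _].
  rewrite addnS -addSn; apply: (IH k.+1 z) => //.
  - exact: descents_step xb l.
  - exact: lo_memr l.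
  have : index x Q < index z Q by rewrite index_filter //; case/and3P: l.
  by lia.
by exists x; [apply: descents_mono xb; rewrite leq_addr|].
Qed.

End Good.

Lemma good_map (V W : eqType) (M : sgraph V) (H : sgraph W) (k : V -> W) w :
  injective k -> (forall a b, H (k a) (k b) = M a b) ->
  good H (map k w) = good M w.
Proof.
move=> ki kM; elim: w => //= x w ->; rewrite mem_map //.
rewrite count_map; congr [&& _, _ <= _ & _].
by apply: eq_count => z /=.
Qed.

(** * Orders compatible with an orientation *)

Section Crossing.
Variables (V : eqType) (M : sgraph V).
Implicit Types (w u s : seq V) (y : rel V) (p : pred V).

(* For a linear order [y] and four distinct points, [cross y f f' h h'] says
   that the pairs [{f, f'}] and [{h, h'}] interleave. *)
Definition cross y (f f' h h' : V) : bool :=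
  (y f h (+) y f' h) (+) (y f h' (+) y f' h').

(** As out-degrees are at most 2, an [f] over [{s, z}] has no other out-neighbour, so the families
    over different pairs are disjoint. Only pairs sharing a vertex [s] are compared. *)
Definition compat y w : Prop :=
  good M w /\ forall (s z z' f f' h h' : V), s != z -> s != z' -> z != z' ->
    lo M w f s -> lo M w f z -> lo M w f' s -> lo M w f' z ->
    lo M w h s -> lo M w h z' -> lo M w h' s -> lo M w h' z' ->
    cross y f f' h h' = false.

Lemma compat_filter y w p : compat y w -> compat y (filter p w).
Proof.
move=> [g c]; split; first exact: good_filter.
move=> s z z' f f' h h' sz sz' zz'.
move=> /lo_filter_sub a /lo_filter_sub b /lo_filter_sub d /lo_filter_sub e.
move=> /lo_filter_sub a' /lo_filter_sub b' /lo_filter_sub d' /lo_filter_sub e'.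
exact: (c s z z').
Qed.

Lemma lo_aut (k : V -> V) w x z : injective k ->
  (forall a b, M (k a) (k b) = M a b) -> lo M (map k w) (k x) (k z) = lo M w x z.
Proof. by move=> ki kM; rewrite /lo !index_map // mem_map // kM. Qed.

Lemma descents_aut (k : V -> V) w v n : injective k ->
  (forall a b, M (k a) (k b) = M a b) ->
  descents M (map k w) (k v) n = map k (descents M w v n).
Proof.
move=> ki kM; elim: n => //= n ->; rewrite map_cat map_flatten -!map_comp.
congr (_ ++ flatten _); apply: eq_map => x /=.
rewrite filter_map; congr (map k _); apply: eq_filter => z /=.
exact: lo_aut.
Qed.

Lemma compat_map y y2 (k : V -> V) w : injective k ->
  (forall a b, M (k a) (k b) = M a b) ->
  {in w &, forall a b, y2 (k a) (k b) = y a b} ->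
  compat y w -> compat y2 (map k w).
Proof.
move=> ki kM ky [g c]; split; first by rewrite (good_map _ ki kM).
move=> s z z' f f' h h' sz sz' zz' fs fz f's f'z hs hz' h's h'z'.
have [s0 _ es] := mapP (lo_memr fs); have [z0 _ ez] := mapP (lo_memr fz).
have [z0' _ ez'] := mapP (lo_memr hz').
have [f0 f0w ef] := mapP (lo_meml fs); have [f0' f0w' ef'] := mapP (lo_meml f's).
have [h0 h0w eh] := mapP (lo_meml hs); have [h0' h0w' eh'] := mapP (lo_meml h's).
move: sz sz' zz' fs fz f's f'z hs hz' h's h'z'.
rewrite {}es {}ez {}ez' {}ef {}ef' {}eh {}eh' /cross !ky //.
rewrite !(inj_eq ki) !lo_aut //; exact: c.
Qed.

End Crossing.

(** * Orientations, self-sufficient sets and extension in the limit *)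

Section Orientations.
Variables (T : finType) (H : sgraph T).

Lemma lo_orientation (w : seq T) : good H w -> w =i T ->
  acyclic_2orientation H (lo H w).
Proof.
move=> gw wT; split.
- move=> x z; split.
    case Hxz: (H x z); last by rewrite /lo Hxz adj_sym Hxz.
    by rewrite lo_total // wT.
  by apply/negP => /andP[/lo_asym ->].
- move=> x; have /goodP[uw /(_ x)] := gw; rewrite wT => /(_ isT).
  rewrite -size_filter; apply: leq_trans; rewrite cardE.
  apply: uniq_leq_size; first exact: enum_uniq.
  by move=> z; rewrite mem_enum inE mem_filter => l; rewrite l wT.
- case=> // x p /andP[/= pth _]; exfalso.
  have ltr : transitive (fun a b => index a w < index b w).
    by move=> b a c; exact: ltn_trans.
  have : path (fun a b => index a w < index b w) x (rcons p x).
    by apply: sub_path pth => a b /and3P[].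
  move/(order_path_min ltr); rewrite all_rcons => /andP[]; by rewrite ltnn.
Qed.

Variable o : rel T.
Hypothesis oH : acyclic_2orientation H o.

(** A rank that drops along every edge; sorting by it turns an acyclic orientation into a list. *)
Definition height x := #|[pred z | connect o x z]|.

Lemma height_lt x z : o x z -> height z < height x.
Proof.
case: oH => _ _ ac oxz; apply/proper_card/properP; split.
  by apply/fintype.subsetP => a; rewrite !inE; apply: connect_trans; exact: connect1.
(* [x] is reachable from itself but not from [z]: a path back would close a directed cycle. *)
exists x; rewrite inE //.
apply/negP => /connectP[p pth e].
case: (shortenP pth) e => p' pth' up' _ e.
have : ucycle o (z :: p').
  apply/andP; split; last exact: up'.
  by rewrite /= rcons_path pth' -e oxz.
by move/ac.
Qed.

End Orientations.

Lemma good_pairwise (V : eqType) (M : sgraph V) (rho : V -> nat) (s : seq V) :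
  uniq s -> pairwise (fun a b => rho b <= rho a) s ->
  (forall x, x \in s -> count (fun z => M x z && (rho z <= rho x)) s <= 2) ->
  good M s.
Proof.
elim: s => //= x s IH /andP[-> us] /andP[/allP xs ps] c /=.
apply/andP; split.
  have := c x (mem_head _ _); rewrite /= adj_irr add0n; apply: leq_trans.
  rewrite (@eq_in_count _ (M x) (fun z => M x z && (rho z <= rho x))) //.
  by move=> z zs; rewrite xs // andbT.
apply: IH => // z zs; have := c z; rewrite inE zs orbT => /(_ isT).
by apply: leq_trans; rewrite leq_addl.
Qed.

Lemma pmap_insub_val (V : choiceType) (A : {fset V}) (w : seq V) :
  {subset w <= A} -> map val (pmap (insub : V -> option A) w) = w.
Proof.
move=> s; rewrite pmap_filter; last exact: insubK.
by apply/all_filterP/allP => x /s xA /=; rewrite isSome_insub.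
Qed.

Lemma le1_list (V : choiceType) (M : sgraph V) (A B : {fset V}) :
  le1 M A B -> exists u w, [/\ good M (u ++ w), w =i A & u ++ w =i B].
Proof.
move=> [sAB [o [oH sc]]].
(* [N] exceeds every height, so [rho] ranks the vertices outside [A] above all of [A]; by
   successor-closure this still respects every edge. *)
pose N := #|{: B}|.+1.
pose rho (x : B) := (if val x \in A then 0 else N) + height o x.
pose le := (fun a b => rho b <= rho a).
have lt : total le by move=> a b; rewrite /le; exact: leq_total.
have ltr : transitive le by move=> b a c h h'; apply: leq_trans h.
pose u := sort le [seq x <- enum {: B} | val x \notin A].
pose w := sort le [seq x <- enum {: B} | val x \in A].
have mu x : (x \in u) = (val x \notin A).
  by rewrite mem_sort mem_filter mem_enum andbT.
have mw x : (x \in w) = (val x \in A).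
  by rewrite mem_sort mem_filter mem_enum andbT.
have hN x : height o x < N by rewrite ltnS max_card.
have uuw : uniq (u ++ w).
  have ue : uniq (enum {: B}) := enum_uniq _.
  rewrite cat_uniq; apply/and3P; split; rewrite ?sort_uniq; try exact: filter_uniq.
  by apply/hasPn => x; rewrite mw /= mu negbK.
have g : good (induced M B) (u ++ w).
  apply: (good_pairwise (rho := rho)) => //.
    rewrite pairwise_cat -!sorted_pairwise // !sort_sorted // !andbT.
    apply/allrelP => x z; rewrite mu mw => xA zA.
    rewrite /rho zA (negbTE xA) add0n; apply: leq_trans _ (leq_addr _ _).
    exact: ltnW.
  move=> x _; have [ori /(_ x) d _] := oH; apply: leq_trans d.
  rewrite -size_filter cardE; apply: uniq_leq_size; first exact: filter_uniq.
  move=> z; rewrite mem_filter mem_enum inE => /andP[/andP[Mxz r] _].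
  have [/esym + _] := ori x z; rewrite Mxz => /orP[//|ozx].
  move: r; rewrite leqNgt; case/negP.
  have := height_lt oH ozx; have := sc z x; rewrite /= /rho.
  case: (val z \in A) => [/(_ isT ozx) ->|_]; first by rewrite !add0n.
  case: (val x \in A); last by rewrite ltn_add2l.
  by move=> _; rewrite add0n; apply: leq_trans (leq_addr _ _); exact: hN.
exists (map val u), (map val w); rewrite -map_cat; split.
- by rewrite (good_map (M := induced M B) (H := M) _ val_inj).
- move=> x; apply/mapP/idP => [[a]|xA]; first by rewrite mw => ? ->.
  by exists [` fsubsetP sAB _ xA]%fset => //; rewrite mw.
- move=> x; apply/mapP/idP => [[a _ ->]|xB]; first exact: valP.
  by exists [` xB]%fset => //; rewrite mem_cat mu mw /= orNb.
Qed.

Lemma list_le1 (V : choiceType) (M : sgraph V) (A B : {fset V}) u w :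
  good M (u ++ w) -> w =i A -> u ++ w =i B -> le1 M A B.
Proof.
move=> g wA uwB; split.
  by apply/fsubsetP => x; rewrite -wA -uwB mem_cat orbC => ->.
set L := pmap (insub : V -> option B) (u ++ w).
have Lv : map val L = u ++ w by apply: pmap_insub_val => x; rewrite uwB.
have gL : good (induced M B) L.
  by rewrite -(good_map (M := induced M B) (H := M) _ val_inj) // Lv.
have LB : L =i {: B}.
  move=> x; rewrite inE -(mem_map val_inj) Lv uwB; exact: valP.
exists (lo (induced M B) L); split; first exact: lo_orientation.
move=> x z /=; rewrite -!wA => xw /and3P[_ + _].
rewrite -![index _ L](index_map val_inj) Lv !index_cat.
have /goodP[+ _] := g; rewrite cat_uniq => /and3P[_ /hasPn d _].
rewrite (negbTE (d _ xw)).
case: ifP => [zu|zu _]; last first.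
  by have := valP z; rewrite -uwB mem_cat zu.
rewrite ltnNge => /negP[]; apply: leq_trans _ (leq_addr _ _).
by apply: ltnW; rewrite index_mem.
Qed.

Definition aut_sym (V : Type) (G : sgraph V) (g : aut G) : aut G.
Proof.
refine (@Aut V G (aut_inv g) g (@aut_invK _ _ g) (@aut_funK _ _ g) _).
by move=> x y; rewrite -(aut_adj g) !aut_invK.
Defined.

Definition aut_comp (V : Type) (G : sgraph V) (g h : aut G) : aut G.
Proof.
refine (@Aut V G (g \o h) (aut_inv h \o aut_inv g) _ _ _).
- by move=> x /=; rewrite !aut_funK.
- by move=> x /=; rewrite !aut_invK.
- by move=> x y /=; rewrite !aut_adj.
Defined.

Definition aut_id (V : Type) (G : sgraph V) : aut G :=
  @Aut V G id id (fun _ => erefl) (fun _ => erefl) (fun _ _ => erefl).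

Lemma aut_inj (V : Type) (G : sgraph V) (g : aut G) : injective g.
Proof. exact: can_inj (@aut_funK _ _ g). Qed.

(** * Self-sufficient sets *)

Section SelfSufficient.
Variables (V : eqType) (M : sgraph V).
Implicit Types (u w : seq V).

(* [X <=_1 M1] for a finite set [X], stated without reference to the chain
   [F]. *)
Definition ssuff (X : seq V) := forall B : seq V,
  exists u w, [/\ good M (u ++ w), w =i X & {subset B <= u ++ w}].

Lemma ssuff_eq X X' : X =i X' -> ssuff X -> ssuff X'.
Proof.
move=> e s B; have [u [w [g wX sB]]] := s B; exists u, w; split=> // x.
by rewrite wX e.
Qed.

Lemma ssuff_good X : ssuff X -> exists2 w, good M w & w =i X.
Proof. by move=> /(_ [::])[u [w [/good_suffix g wX _]]]; exists w. Qed.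

(** Transitivity: in a list ending with the whole set, that end may be replaced by [u ++ w]. *)
Lemma ssuff_suffix u w : good M (u ++ w) -> ssuff (u ++ w) -> ssuff w.
Proof.
move=> g s B; have [u' [w' [g' e sB]]] := s B.
exists (u' ++ u), w; rewrite -catA; split=> //; first exact: good_replace g' g e.
by move=> x /sB; rewrite !mem_cat e mem_cat.
Qed.

Lemma ssuff_aut (g : aut M) X : ssuff X -> ssuff (map g X).
Proof.
move=> s B; have [u [w [gd e sB]]] := s (map (aut_sym g) B).
exists (map g u), (map g w); rewrite -map_cat; split.
- by rewrite (good_map (M := M) (H := M) _ (@aut_inj _ _ g) (aut_adj g)).
- by move=> x; apply/mapP/mapP => -[a]; rewrite ?e => aw ->; exists a; rewrite ?e.
- move=> x /(map_f (aut_sym g))/sB/(map_f g) /=.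
  by rewrite aut_invK.
Qed.

(* The map matching two lists entry by entry is an isomorphism. *)
Fixpoint matching w w' : Prop :=
  match w, w' with
  | x :: w1, x' :: w1' => map (M x) w1 = map (M x') w1' /\ matching w1 w1'
  | [::], [::] => True
  | _, _ => False
  end.

Lemma matching_size w w' : matching w w' -> size w = size w'.
Proof. by elim: w w' => [|x w IH] [|x' w'] //= [_ /IH ->]. Qed.

Lemma matching_nth v w w' i j : matching w w' -> i < size w -> j < size w ->
  M (nth v w i) (nth v w j) = M (nth v w' i) (nth v w' j).
Proof.
elim: w w' i j => [|x w IH] [|x' w'] //= i j [e m].
have h k : k < size w -> M x (nth v w k) = M x' (nth v w' k).
  move=> kw; have := congr1 (fun s => nth false s k) e.
  by rewrite !(nth_map v) // -(matching_size m).
case: i j => [|i] [|j] /=; rewrite ?ltnS.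
- by rewrite !adj_irr.
- by move=> _; exact: h.
- by rewrite ![M _ x]adj_sym ![M _ x']adj_sym => /h.
- exact: IH.
Qed.

Lemma matching_refl w : matching w w.
Proof. by elim: w => //= x w; split. Qed.

End SelfSufficient.

Lemma matching_map2 (V W : eqType) (M : sgraph V) (H : sgraph W)
    (k l : W -> V) w :
  (forall a b, M (k a) (k b) = H a b) -> (forall a b, M (l a) (l b) = H a b) ->
  matching M (map k w) (map l w).
Proof.
move=> kH lH; elim: w => //= x w IH; split=> //; rewrite -!map_comp.
by apply: eq_map => z /=; rewrite kH lH.
Qed.

Section Chain.
Variables (V : countType) (M : sgraph V) (F : nat -> {fset V}).
Hypothesis F_le1 : forall n, le1 M (F n) (F n.+1).
Hypothesis F_cover : forall x, exists n, x \in F n.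

Lemma chain_mono n k x : x \in F n -> x \in F (n + k).
Proof.
move=> xF; elim: k => [|k IH]; rewrite ?addn0 // addnS.
by have [/fsubsetP s _] := F_le1 (n + k); exact: s.
Qed.

Lemma chain_covers (B : seq V) n :
  exists2 m, n <= m & {subset B <= F m}.
Proof.
elim: B => [|b B [m nm sB]]; first by exists n.
have [k bk] := F_cover b; exists (k + m); first by apply: leq_trans (leq_addl _ _).
move=> x; rewrite inE => /predU1P[->|/sB xF]; first exact: chain_mono.
by rewrite addnC; exact: chain_mono.
Qed.

Lemma chain_list n k w : good M w -> w =i F n ->
  exists u, good M (u ++ w) /\ u ++ w =i F (n + k).
Proof.
move=> gw wF; elim: k => [|k [u [g e]]]; first by exists [::]; rewrite addn0.
have [u1 [w1 [g1 e1 e2]]] := le1_list (F_le1 (n + k)).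
exists (u1 ++ u); rewrite -catA; split.
  by apply: good_replace g1 g _ => x; rewrite e1 e.
by move=> x; rewrite addnS -e2 !mem_cat e1 -e mem_cat.
Qed.

Lemma chain_ssuff n : ssuff M (F n).
Proof.
move=> B; have [m nm sB] := chain_covers B n.
have [u0 [w [/good_suffix g e _]]] := le1_list (F_le1 n).
have [u [gu eu]] := chain_list (m - n) g e.
exists u, w; split=> // x /sB; by rewrite eu subnKC.
Qed.

(** One direction is transitivity through [F n]. For the other, a list that ends with [A] and covers
    [F n] is restricted to [F n]. *)
Lemma le1_chainP (A : {fset V}) : le1_chain M F A <-> ssuff M A.
Proof.
split=> [[n [_ /le1_list[u [w [g wA e]]]]]|s].
  apply: ssuff_eq wA _; apply: ssuff_suffix g _.
  by apply: ssuff_eq (chain_ssuff n) => x; rewrite e.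
have [n _ sA] := chain_covers A 0.
have [u [w [g e sF]]] := s (F n).
exists n; split; first exact/fsubsetP.
apply: (@list_le1 _ _ _ _ [seq x <- u | x \in F n] [seq x <- w | x \in F n]).
- by rewrite -filter_cat; exact: good_filter.
- by move=> x; rewrite mem_filter e andb_idl // => /sA.
- by move=> x; rewrite -filter_cat mem_filter andb_idr // => /sF.
Qed.

End Chain.

Section FraisseLimit.
Variables (V : countType) (M : sgraph V).
Hypothesis HM : fraisse_limit_C1 M.

Lemma ssuff_extend (w : seq V) : exists2 X, ssuff M X & {subset w <= X}.
Proof.
have [F [F1 F2 _ _]] := HM; have [m _ s] := chain_covers F1 F2 w 0.
by exists (F m) => //; exact: chain_ssuff.
Qed.

Lemma ssuff_homogeneous (w w' : seq V) : uniq w -> uniq w' ->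
  ssuff M w -> ssuff M w' -> matching M w w' ->
  exists g : aut M, map g w = w'.
Proof.
move=> uw uw' sw sw' m; have [F [F1 F2 _ F4]] := HM.
have sz := matching_size m.
pose A := seq_fset tt w; pose A' := seq_fset tt w'.
have Aw : A =i w := seq_fsetE tt w.
have Aw' : A' =i w' := seq_fsetE tt w'.
have f_in (x : A) : nth (val x) w' (index (val x) w) \in A'.
  by rewrite Aw' mem_nth // -sz index_mem -Aw fsvalP.
have f'_in (x : A') : nth (val x) w (index (val x) w') \in A.
  by rewrite Aw mem_nth // sz index_mem -Aw' fsvalP.
pose f (x : A) : A' := [` f_in x]%fset.
pose f' (x : A') : A := [` f'_in x]%fset.
have wi (x : A) : index (val x) w < size w by rewrite index_mem -Aw fsvalP.
have wi' (x : A') : index (val x) w' < size w' by rewrite index_mem -Aw' fsvalP.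
have nI d (x : A) : nth d w (index (val x) w) = val x.
  by rewrite (set_nth_default (val x)) // nth_index // -Aw fsvalP.
have nI' d (x : A') : nth d w' (index (val x) w') = val x.
  by rewrite (set_nth_default (val x)) // nth_index // -Aw' fsvalP.
have iso : graph_iso (induced M A) (induced M A') f.
  split.
    exists f' => x; apply: val_inj => /=.
      by rewrite index_uniq -?sz //; [exact: nI|exact: wi].
    by rewrite index_uniq ?sz //; [exact: nI'|exact: wi'].
  move=> x z; rewrite /induced /=.
  rewrite (@set_nth_default _ w' (val x) (val z)) -?sz //; last exact: wi.
  rewrite -(matching_nth (val x) m); [|exact: wi..].
  by congr (M _ _); exact: nI.
have cA : le1_chain M F A.
  by apply/(le1_chainP F1 F2)/(@ssuff_eq _ _ w) => // x; rewrite Aw.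
have cA' : le1_chain M F A'.
  by apply/(le1_chainP F1 F2)/(@ssuff_eq _ _ w') => // x; rewrite Aw'.
have [g gf] := F4 A A' cA cA' f iso.
(* [nth] needs a default vertex, so the empty list is treated apart. *)
exists g; have [w0|[v vw]] : w = [::] \/ exists v, v \in w.
- by case: (w) => [|v u]; [left|right; exists v; rewrite mem_head].
- by move: sz; rewrite w0; case: (w').
apply: (@eq_from_nth _ v) => [|i]; rewrite size_map // => iw.
have xA : nth v w i \in A by rewrite Aw mem_nth.
rewrite (nth_map v) // (gf [` xA]%fset) /= index_uniq //.
by apply: set_nth_default; rewrite -sz.
Qed.

(** The graph on [w] with one more vertex [None] joined to [P] is in the class, since [None] can be
    listed first. Universality embeds it self-sufficiently, and homogeneity moves the image of [w]
    back onto [w]. *)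
Lemma ssuff_add1 (w P : seq V) : ssuff M w -> size P <= 2 ->
  exists v, [/\ v \notin w, ssuff M (v :: w) &
    {in w, forall x, M v x = (x \in P)}].
Proof.
move=> sw P2; have [F [F1 F2 F3 _]] := HM.
have [w0 gw0 e0] := ssuff_good sw.
pose A := seq_fset tt w0.
have Aw : A =i w0 := seq_fsetE tt w0.
pose wA : seq A := pmap insub w0.
have wAv : map val wA = w0 by apply: pmap_insub_val => x; rewrite Aw.
pose h (a b : option A) := match a, b with
  | Some a, Some b => M (val a) (val b)
  | None, Some b => val b \in P
  | Some a, None => val a \in P
  | None, None => false
  end.
have hsym : symmetric h by move=> [a|] [b|] //=; exact: adj_sym.
have hirr : irreflexive h by move=> [a|] //=; exact: adj_irr.
pose H := SGraph hsym hirr.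
have Some_inj : injective (@Some A) by move=> a b [].
have gS : good H (map Some wA).
  rewrite (good_map (M := induced M A) (H := H)) //.
  by rewrite -(good_map (M := induced M A) (H := M) _ val_inj) // wAv.
have gA : good H (None :: map Some wA).
  apply/and3P; split.
  - by apply/mapP => -[].
  - rewrite count_map; apply: leq_trans P2; rewrite -size_filter.
    rewrite -(size_map val); apply: uniq_leq_size.
      rewrite map_inj_uniq; last exact: val_inj.
      apply: filter_uniq; rewrite -(map_inj_uniq val_inj) wAv.
      exact: good_uniq gw0.
    by move=> x /mapP[a]; rewrite mem_filter => /andP[aP _] ->.
  - exact: gS.
have C1H : C1 H.
  exists (lo H (None :: map Some wA)); apply: lo_orientation => //.
  case=> [a|]; rewrite inE //= mem_map // -(mem_map val_inj) wAv -Aw.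
  exact: fsvalP.
have [A1 [/(le1_chainP F1 F2) cA1 [f [fb fM]]]] := F3 _ H C1H.
pose k (a : option A) := val (f a).
have ki : injective k by apply: inj_comp; [exact: val_inj|exact: bij_inj].
pose w1 := map k (map Some wA).
have g1 : good M (k None :: w1).
  by rewrite -[_ :: _]/(map k (None :: map Some wA)) (good_map (M := H)).
have s1 : ssuff M (k None :: w1).
  apply: ssuff_eq cA1 => x; rewrite -[_ :: _]/(map k (None :: map Some wA)).
  apply/idP/mapP => [xA|[a _ ->]]; last exact: fsvalP.
  have [f' fK f'K] := fb; exists (f' [` xA]%fset); last by rewrite /k f'K.
  case: (f' _) => [a|]; rewrite inE //= mem_map // -(mem_map val_inj) wAv -Aw.
  exact: fsvalP.
have m : matching M w0 w1.
  rewrite /w1 -wAv -map_comp.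
  apply: (@matching_map2 _ _ _ (induced M A)) => // a b.
  exact: (fM (Some a) (Some b)).
have s0 : ssuff M w0 by apply: ssuff_eq sw => x; rewrite e0.
have [g gw] : exists g : aut M, map g w0 = w1.
  apply: ssuff_homogeneous => //; first exact: good_uniq gw0.
    by have /andP[] := good_uniq g1.
  by apply: (@ssuff_suffix _ _ [:: k None]).
exists (aut_inv g (k None)); split.
- rewrite -e0 -(mem_map (@aut_inj _ _ g)) gw aut_invK.
  by have /andP[] := g1.
- have := ssuff_aut (aut_sym g) s1; rewrite /= -gw -map_comp.
  apply: ssuff_eq => x; rewrite !inE (eq_map (g := id)) ?map_id ?e0 //.
  by move=> z /=; rewrite aut_funK.
- move=> x; rewrite -e0 -{1}wAv => /mapP[a aw ->].
  rewrite -(aut_adj g) aut_invK.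
  have -> : g (val a) = k (Some a).
    move: gw; rewrite /w1 -{1}wAv -!map_comp => /eq_in_map; exact.
  exact: (fM None (Some a)).
Qed.

End FraisseLimit.

(** * Copies on which an order is compatible with the graph *)

(** Iterated pigeonhole: each test [f i] keeps at least half of the points. *)
Lemma const_subseq (T I : eqType) (f : I -> pred T) (l : seq I) n :
  exists N, forall E : seq T, uniq E -> N <= size E ->
    exists E', [/\ size E' = n, uniq E', {subset E' <= E} &
      forall i, i \in l -> {in E' &, forall a b, f i a = f i b}].
Proof.
elim: l n => [|i l IH] n.
  exists n => E uE nE; exists (take n E); split=> //.
  - exact: size_takel.
  - exact: take_uniq.
  - exact: mem_take.
have [N hN] := IH (2 * n); exists N => E uE /(hN E uE)[E1 [s1 u1 sub1 c1]].
have [b nb] : exists b, n <= size [seq x <- E1 | f i x == b].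
  have := count_predC (f i) E1; rewrite s1 => e.
  have [nb|nb] := leqP n (count (f i) E1); [exists true|exists false].
    by rewrite size_filter (eq_count (a2 := f i)) // => x /=; rewrite eqb_id.
  rewrite size_filter (eq_count (a2 := predC (f i))); first by lia.
  by move=> x /=; rewrite eqbF_neg.
exists (take n [seq x <- E1 | f i x == b]).
have sub x : x \in take n [seq x <- E1 | f i x == b] -> (f i x == b) && (x \in E1).
  by move/mem_take; rewrite mem_filter.
split.
- exact: size_takel.
- exact/take_uniq/filter_uniq.
- by move=> x /sub/andP[_ /sub1].
- move=> j; rewrite inE => /predU1P[-> a c /sub/andP[/eqP -> _] /sub/andP[/eqP -> _] //|].
  by move=> jl a c /sub/andP[_ aE] /sub/andP[_ cE]; exact: c1.
Qed.

Section Pools.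
Variables (V : countType) (M : sgraph V).
Hypothesis HM : fraisse_limit_C1 M.
Implicit Types (w u P E : seq V) (y : rel V).

Definition independent E := {in E &, forall a b, M a b = false}.

Definition attached E w P := {in E & w, forall e x, M e x = (x \in P)}.

Lemma good_pool E w P : uniq (E ++ w) -> good M w -> independent E ->
  attached E w P -> size P <= 2 -> good M (E ++ w).
Proof.
move=> + gw + + P2; elim: E => //= e E IH /andP[en u] ind att.
rewrite en IH //; first last.
- by move=> a b aE bE; apply: att; rewrite // inE aE orbT.
- by move=> a b aE bE; apply: ind; rewrite inE ?aE ?bE orbT.
rewrite andbT count_cat (@eq_in_count _ _ pred0 E) ?count_pred0; last first.
  by move=> x xE; apply: ind; rewrite inE ?eqxx ?xE ?orbT.
apply: leq_trans P2; rewrite add0n (@eq_in_count _ _ (mem P) w); last first.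
  by move=> x xw; apply: att; rewrite ?mem_head.
rewrite -size_filter; apply: uniq_leq_size.
  apply: filter_uniq; exact: good_uniq gw.
by move=> x; rewrite mem_filter => /andP[].
Qed.

Lemma pool w P n : ssuff M w -> uniq w -> {subset P <= w} -> size P <= 2 ->
  exists E, [/\ size E = n, uniq (E ++ w), ssuff M (E ++ w), attached E w P &
    independent E].
Proof.
move=> sw uw Pw P2; elim: n => [|n [E [sE uE ssE att ind]]].
  by exists [::]; split.
have [v [vn sv adj]] := ssuff_add1 HM ssE P2.
exists (v :: E); split=> /=; first by rewrite sE.
- by rewrite vn uE.
- exact: sv.
- move=> e x; rewrite inE => /predU1P[->|eE] xw; last exact: att.
  by rewrite adj // mem_cat xw orbT.
- have vE x : x \in E -> M v x = false.
    move=> xE; rewrite adj ?mem_cat ?xE //.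
    apply/negbTE; apply/negP => /Pw xw.
    move: uE; rewrite cat_uniq => /and3P[_ /hasPn/(_ x xw)].
    by rewrite /= xE.
  move=> a b; rewrite !inE => /predU1P[->|aE] /predU1P[->|bE].
  + exact: adj_irr.
  + exact: vE.
  + by rewrite adj_sym vE.
  + exact: ind.
Qed.

(** The discarded vertices of [E] can be listed on top of [E'], as [E] is independent. *)
Lemma ssuff_subpool E E' w P : ssuff M w -> ssuff M (E ++ w) ->
  uniq (E ++ w) -> independent E -> attached E w P -> size P <= 2 ->
  uniq E' -> {subset E' <= E} -> ssuff M (E' ++ w).
Proof.
move=> sw sE uE ind att P2 uE' sub; have [w0 g0 e0] := ssuff_good sw.
have uw0 := good_uniq g0.
have [uEE /hasPn dis uw] := and3P (etrans (esym (cat_uniq _ _)) uE).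
have dis0 (B : seq V) : uniq B -> {subset B <= E} -> uniq (B ++ w0).
  move=> uB sB; rewrite cat_uniq uB uw0 andbT /=.
  by apply/hasPn => x; rewrite e0 => /dis; apply: contra => /sB.
apply: (@ssuff_eq _ _ (E' ++ w0)); first by move=> x; rewrite !mem_cat e0.
pose E2 := [seq x <- E | x \notin E'].
apply: (@ssuff_suffix _ _ E2).
  rewrite catA; apply: (good_pool (P := P)) => //.
  - apply: dis0 => [|x]; rewrite ?mem_cat.
      rewrite cat_uniq uE' filter_uniq // andbT /=.
      by apply/hasPn => x xE'; rewrite /= mem_filter xE'.
    by case/orP => [|/sub //]; rewrite mem_filter => /andP[].
  - move=> a b; rewrite !mem_cat !mem_filter => aE bE; apply: ind.
      by case/orP: aE => [/andP[]|/sub].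
    by case/orP: bE => [/andP[]|/sub].
  - move=> a b; rewrite !mem_cat !mem_filter e0 => aE bE; apply: att => //.
    by case/orP: aE => [/andP[]|/sub].
apply: ssuff_eq sE => x; rewrite !mem_cat mem_filter e0.
by case: (boolP (x \in E')) => [/sub ->|].
Qed.

(** From a large pool the pigeonhole keeps vertices lying in one cut of [w]. Both sides of [y] are
    tested because [y] is an arbitrary relation here. *)
Lemma mono_pool y w P n : ssuff M w -> uniq w -> {subset P <= w} ->
  size P <= 2 ->
  exists E, [/\ size E = n, uniq (E ++ w), ssuff M (E ++ w), attached E w P &
    independent E] /\
    (forall x a b, x \in w -> a \in E -> b \in E ->
       y a x = y b x /\ y x a = y x b).
Proof.
move=> sw uw Pw P2.
pose f (i : bool * V) x := if i.1 then y x i.2 else y i.2 x.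
have [N hN] := const_subseq f [seq (b, x) | b <- [:: true; false], x <- w] n.
have [E [sE uE ssE att ind]] := pool N sw uw Pw P2.
have [uEE /hasPn dis _] := and3P (etrans (esym (cat_uniq _ _)) uE).
have [|E' [sE' uE' sub c]] := hN E uEE; first by rewrite sE.
exists E'; split; last first.
  move=> x a b xw aE bE; split; [apply: (c (true, x))|apply: (c (false, x))] => //.
    by apply/allpairsP; exists (true, x).
  by apply/allpairsP; exists (false, x).
split=> //.
- rewrite cat_uniq uE' uw andbT /=.
  by apply/hasPn => x /dis; apply: contra => /sub.
- exact: ssuff_subpool ssE _ ind att P2 _ _.
- by move=> a b /sub aE; exact: att.
- by move=> a b /sub aE /sub bE; exact: ind.
Qed.

Lemma matching_pool E E' w P : size E = size E' -> independent E ->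
  independent E' -> attached E w P -> attached E' w P ->
  matching M (E ++ w) (E' ++ w).
Proof.
elim: E E' => [|e E IH] [|e' E'] //= => [_ _ _ _ _|[sE] i i' a a'].
  exact: matching_refl.
split; last first.
  apply: IH => // x z xE zE; [apply: i|apply: i'|apply: a|apply: a'];
  by rewrite ?inE ?xE ?zE ?orbT.
rewrite !map_cat; congr (_ ++ _); last first.
  by apply/eq_in_map => x xw; rewrite a ?a' ?mem_head.
have h (F : seq V) x : (forall z, z \in F -> M x z = false) ->
    map (M x) F = nseq (size F) false.
  elim: F => //= z F IHF hF; rewrite hF ?mem_head // IHF // => q qF.
  by apply: hF; rewrite inE qF orbT.
by rewrite !h ?sE // => z zE; [apply: i'|apply: i]; rewrite inE ?eqxx ?zE ?orbT.
Qed.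

(* No vertex of [u] will enter a family that already has a member in [d]. *)
Definition fresh u d := forall x f s z, x \in u -> f \in d -> s != z ->
  lo M (u ++ d) x s -> lo M (u ++ d) x z -> lo M d f s -> lo M d f z -> False.

(* The vertices over a given pair are added all at once, so that by the
   pigeonhole principle they can be taken in a single cut of [d]. *)
Lemma compat_copy_aux n u d y : size u <= n -> good M (u ++ d) ->
  ssuff M (u ++ d) -> compat M y d -> fresh u d ->
  exists (g : aut M) w,
    w =i u ++ d /\ compat M (fun a b => y (g a) (g b)) w.
Proof.
elim: n u d y => [|n IH] u d y.
  by case: u => // _ _ _ cd _; exists (aut_id M), d.
case/lastP: u => [|u0 x0]; first by move=> _ _ _ cd _; exists (aut_id M), d.
set u := rcons u0 x0 => su g s cd fr.
have uud := good_uniq g; have gd := good_suffix g.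
have [uu /hasPn dis ud] := and3P (etrans (esym (cat_uniq _ _)) uud).
(* All out-neighbours of the last entry [x0] lie in [d]. [K] collects the vertices of [u] with
   exactly the same out-neighbours as [x0]. *)
pose inK x := all (fun z => ~~ lo M u x z) u && all (fun q => M x q == M x0 q) d.
pose K := [seq x <- u | inK x]; pose u' := [seq x <- u | ~~ inK x].
pose P := [seq q <- d | M x0 q].
have P2 : size P <= 2.
  have : good M (x0 :: d) by apply: (@good_suffix _ _ u0); rewrite -cat_rcons.
  by rewrite size_filter => /and3P[].
have Pd : {subset P <= d} by move=> q; rewrite mem_filter => /andP[].
have x0u : x0 \in u by rewrite mem_rcons mem_head.
have x0K : inK x0.
  apply/andP; split; last by apply/allP => q _.
  apply/allP => z zu; apply/negP => /and3P[_ + _].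
  have x0u0 : x0 \notin u0 by move: uu; rewrite rcons_uniq => /andP[].
  have -> : index x0 u = size u0.
    by rewrite /u -cats1 index_cat (negbTE x0u0) /= eqxx addn0.
  by move: zu; rewrite -index_mem [size u]size_rcons ltnS leqNgt => /negbTE ->.
have Knl x z : x \in K -> z \in u -> ~~ lo M u x z.
  by rewrite mem_filter => /andP[/andP[/allP h _] _] /h.
have KP x q : x \in K -> q \in d -> M x q = (q \in P).
  rewrite !mem_filter => /andP[/andP[_ /allP h] _] qd.
  by rewrite (eqP (h q qd)) qd andbT.
have Ku x : x \in K -> x \in u by rewrite mem_filter => /andP[].
have u'u x : x \in u' -> x \in u by rewrite mem_filter => /andP[].
have Kind : independent K.
  move=> a b aK bK; apply/negP => m.
  have := lo_total (Ku a aK) (Ku b bK) m.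
  by rewrite (negbTE (Knl a b aK (Ku b bK))) (negbTE (Knl b a bK (Ku a aK))).
have Katt : attached K d P by move=> a b; exact: KP.
have e : u' ++ K ++ d =i u ++ d.
  move=> x; rewrite catA !mem_cat !mem_filter.
  by case: (x \in u) (inK x) => [] [].
have uw' : uniq (u' ++ K ++ d).
  rewrite catA cat_uniq ud andbT; apply/andP; split.
    rewrite cat_uniq !filter_uniq // andbT /=.
    by apply/hasPn => x /=; rewrite !mem_filter => /andP[->].
  by apply/hasPn => x /dis; rewrite /= mem_cat; apply: contra => /orP[/u'u|/Ku].
have uKd : uniq (K ++ d) by move: uw'; rewrite cat_uniq => /and3P[].
(* Moving [K] down to just above [d] reverses no edge, because nothing in [K] points into [u]. *)
have lsub x z : lo M (u' ++ K ++ d) x z -> lo M (u ++ d) x z.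
  move=> l; have m := lo_adj l.
  have := lo_meml l; rewrite mem_cat => /orP[xu'|xKd].
    have xu := u'u x xu'.
    have := lo_memr l; rewrite !mem_cat => /or3P[zu'|zK|zd].
    - have zu := u'u z zu'; rewrite lo_catl //.
      by move: l; rewrite lo_catl // => /lo_filter_sub.
    - have zu := Ku z zK; rewrite lo_catl //.
      have := lo_total xu zu m; by rewrite (negbTE (Knl z x zK xu)) orbF.
    - by rewrite lo_catlr.
  rewrite lo_catr // in l.
  move: xKd; rewrite mem_cat => /orP[xK|xd].
    have := lo_memr l; rewrite mem_cat => /orP[zK|zd].
      by rewrite Kind // in m.
    by rewrite lo_catlr // Ku.
  by rewrite lo_catr // in l; rewrite lo_catr.
have g' : good M (u' ++ K ++ d) by exact: good_lo lsub.
have s' : ssuff M (u' ++ K ++ d) by apply: ssuff_eq s => x; rewrite e.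
have sKd := ssuff_suffix g' s'.
have sd := ssuff_suffix g s.
(* [E] is a copy of [K] over [d] inside one cut of [d]; the automorphism [h] fixes [d] and carries
   [K] to [E]. *)
have [E [[sE uE ssE att ind] mono]] := mono_pool y (size K) sd ud Pd P2.
have [h hE] : exists h : aut M, map h (K ++ d) = E ++ d.
  apply: ssuff_homogeneous => //.
  by apply: (matching_pool (P := P)).
have hd x : x \in d -> h x = x.
  move: hE; rewrite map_cat => /eqP; rewrite eqseq_cat ?size_map //.
  case/andP=> _ /eqP hd xd; rewrite -[in RHS](map_id d) in hd.
  by move/eq_in_map: hd => /(_ x xd).
have hK x : x \in K -> h x \in E.
  move: hE; rewrite map_cat => /eqP; rewrite eqseq_cat ?size_map //.
  by case/andP=> /eqP <- _ xK; exact: map_f.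
pose y' a b := y (h a) (h b).
have lKd f q : f \in K -> lo M (K ++ d) f q -> q \in d /\ q \in P.
  move=> fK l; have := lo_memr l; rewrite mem_cat => /orP[qK|qd].
    by have := lo_adj l; rewrite Kind.
  by split=> //; rewrite -(KP f) // (lo_adj l).
(* By freshness, a family that meets [K] lies inside [K]. *)
have nofresh f f' q q' : q != q' -> f \in K -> lo M (K ++ d) f q ->
    lo M (K ++ d) f q' -> lo M (K ++ d) f' q -> lo M (K ++ d) f' q' -> f' \in K.
  move=> qq' fK l l' m m'.
  have := lo_meml m; rewrite mem_cat => /orP[//|f'd].
  have up a : lo M (K ++ d) f a -> lo M (u ++ d) f a.
    by move=> la; apply: lsub; rewrite lo_catr // mem_cat fK.
  rewrite lo_catr // in m; rewrite lo_catr // in m'.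
  by case: (fr f f' q q' (Ku f fK) f'd qq' (up _ l) (up _ l') m m').
have P3 a b c : a \in P -> b \in P -> c \in P -> a != b -> a != c -> b != c -> False.
  move=> aP bP cP ab ac bc; suff : 2 < size P by rewrite ltnNge P2.
  apply: (@uniq_leq_size _ [:: a; b; c]).
    by rewrite /= !inE negb_or ab ac bc.
  by move=> x; rewrite !inE => /or3P[] /eqP ->.
(* If one family lies in [K], its pair exhausts [P], so the other family lies in [d] and sees all of
   [E] on the same side. If neither does, compatibility on [d] applies. *)
have cKd : compat M y' (K ++ d).
  split; first exact: good_suffix g'.
  move=> a b c f f' k k' ab ac bc fa fb f'a f'b ka kc k'a k'c.
  case: (boolP (f \in K)) => fK.
    have f'K : f' \in K by apply: (nofresh f f' a b).
    have kd q : q \in K -> lo M (K ++ d) q a -> lo M (K ++ d) q c -> False.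
      move=> qK l l'; apply: (P3 a b c) => //.
      - by have [] := lKd _ _ fK fa.
      - by have [] := lKd _ _ fK fb.
      - by have [] := lKd _ _ qK l'.
    have kd1 : k \in d.
      by have := lo_meml ka; rewrite mem_cat => /orP[/kd/(_ ka kc)|].
    have kd2 : k' \in d.
      by have := lo_meml k'a; rewrite mem_cat => /orP[/kd/(_ k'a k'c)|].
    rewrite /cross /y' !(hd k) // !(hd k') //.
    have [-> _] := mono k (h f) (h f') kd1 (hK f fK) (hK f' f'K).
    have [-> _] := mono k' (h f) (h f') kd2 (hK f fK) (hK f' f'K).
    by rewrite !addbb.
  have fd : f \in d by have := lo_meml fa; rewrite mem_cat (negbTE fK).
  have f'd : f' \in d.
    have := lo_meml f'a; rewrite mem_cat => /orP[f'K|//].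
    by case/negP: fK; apply: (nofresh f' f a b).
  case: (boolP (k \in K)) => kK.
    have k'K : k' \in K by apply: (nofresh k k' a c).
    rewrite /cross /y' !(hd f) // !(hd f') //.
    have [_ ->] := mono f (h k) (h k') fd (hK k kK) (hK k' k'K).
    have [_ ->] := mono f' (h k) (h k') f'd (hK k kK) (hK k' k'K).
    by rewrite addbb.
  have kd : k \in d by have := lo_meml ka; rewrite mem_cat (negbTE kK).
  have k'd : k' \in d.
    have := lo_meml k'a; rewrite mem_cat => /orP[k'K|//].
    by case/negP: kK; apply: (nofresh k' k a c).
  rewrite /cross /y' !hd //.
  rewrite !(@lo_catr _ _ K) // in fa fb f'a f'b ka kc k'a k'c.
  by case: cd => _ cdd; apply: (cdd a b c).
(* A vertex of [u'] entering the family of a member of [K] would have the out-neighbours of [x0],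
   hence belong to [K]. *)
have fr' : fresh u' (K ++ d).
  move=> x f a b xu' fKd ab xa xb fa fb.
  have xu := u'u x xu'.
  have xa' := lsub _ _ xa; have xb' := lsub _ _ xb.
  move: (fKd); rewrite mem_cat => /orP[fK|fd]; last first.
    rewrite lo_catr // in fa; rewrite lo_catr // in fb.
    exact: (fr x f a b).
  have [ad aP] := lKd _ _ fK fa; have [bd bP] := lKd _ _ fK fb.
  have only q : lo M (u ++ d) x q -> (q == a) || (q == b).
    move=> l; apply/negPn/negP; rewrite negb_or => /andP[qa qb].
    have /= := @good_le2 _ _ _ x [:: q; a; b] g.
    by rewrite /= !inE negb_or qa qb ab l xa' xb' => /(_ isT isT).
  suff xK : inK x by move: xu'; rewrite mem_filter xK.
  apply/andP; split; apply/allP.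
    move=> z zu; apply/negP => l.
    have : lo M (u ++ d) x z by rewrite lo_catl.
    by case/only/orP => /eqP ez; have := dis z; rewrite ez ?ad ?bd -?ez /= zu =>
      /(_ isT).
  move=> q qd; apply/eqP; apply/idP/idP => m.
    have : lo M (u ++ d) x q by rewrite lo_catlr.
    case/only/orP => /eqP ->.
      by move: aP; rewrite mem_filter => /andP[].
    by move: bP; rewrite mem_filter => /andP[].
  have qP : q \in P by rewrite mem_filter m.
  have : (q == a) || (q == b).
    apply/negPn/negP; rewrite negb_or => /andP[qa qb].
    exact: (P3 q a b).
  by case/orP => /eqP ->; [exact: lo_adj xa'|exact: lo_adj xb'].
have su' : size u' <= n.
  have c0 : 0 < count inK u by rewrite -has_count; apply/hasP; exists x0.
  rewrite [size u']size_filter -ltnS; apply: leq_trans su.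
  by rewrite -(count_predC inK u) -{1}[count _ u]add0n ltn_add2r.
have [k [w [we wc]]] := IH u' (K ++ d) y' su' g' s' cKd fr'.
exists (aut_comp h k), w; split=> // x; by rewrite we e.
Qed.

Lemma compat_copy y w : ssuff M w -> exists (g : aut M) w',
  w' =i w /\ compat M (fun a b => y (g a) (g b)) w'.
Proof.
move=> sw; have [w0 g0 e0] := ssuff_good sw.
have s0 : ssuff M (w0 ++ [::]) by apply: ssuff_eq sw => x; rewrite cats0 e0.
have g0' : good M (w0 ++ [::]) by rewrite cats0.
have c0 : compat M y [::] by split=> // s z z' f f' h h' _ _ _ /lo_meml.
have f0 : fresh w0 [::] by move=> x f s z _; rewrite in_nil.
have [g [w' [e c]]] := compat_copy_aux (leqnn _) g0' s0 c0 f0.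
by exists g, w'; split=> // x; rewrite e cats0 e0.
Qed.

End Pools.

(** * Edges whose direction is forced *)

Lemma seq_argmin (T : eqType) (f : T -> nat) (D : seq T) x : x \in D ->
  exists2 h, h \in D & forall d, d \in D -> f h <= f d.
Proof.
elim: D x => // a D IH x _; case: D IH => [_|b D /(_ b (mem_head _ _))].
  by exists a; rewrite ?mem_head // => d; rewrite inE => /eqP ->.
move=> [h hD hmin]; have [ah|ha] := leqP (f a) (f h).
  exists a; first exact: mem_head.
  by move=> d; rewrite inE => /predU1P[->//|/hmin]; apply: leq_trans.
exists h; first by rewrite inE hD orbT.
by move=> d; rewrite inE => /predU1P[->|/hmin //]; exact: ltnW.
Qed.

Lemma mask_mem (T : eqType) (b : bitseq) (l : seq T) : uniq l ->
  size b = size l -> map (fun z => z \in mask b l) l = b.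
Proof.
elim: l b => [|x l IH] [|c b] //= /andP[xl ul] [sb]; congr (_ :: _).
  case: c => /=; first by rewrite mem_head.
  by apply/negbTE; apply: contra xl => /mem_mask.
rewrite -[RHS](IH b) //; apply/eq_in_map => z zl.
case: c => //=; rewrite inE; case: eqP => // e.
by rewrite e (negbTE xl) in zl.
Qed.

Section Forcing.
Variables (V : countType) (M : sgraph V).
Hypothesis HM : fraisse_limit_C1 M.
Implicit Types (w u P E : seq V) (y : rel V).

(** A lower bound on the size of the self-sufficient closure of [s]. *)
Definition deep n s :=
  forall X : seq V, uniq X -> ssuff M X -> s \in X -> n <= size X.

(** The graph on [D] alone forces [s] to come first, whatever the orientation. *)
Definition apex (D : seq V) s := forall w, good M w -> {subset D <= w} ->
  forall d, d \in D -> index s w <= index d w.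

Lemma index_lo w x z : x \in w -> z \in w -> M x z ->
  index x w <= index z w -> lo M w x z.
Proof.
move=> xw zw m i; have := lo_total xw zw m.
by case/orP => // /and3P[_]; rewrite ltnNge i.
Qed.

Lemma good_le2F w x a b c : good M w -> uniq [:: a; b; c] ->
  lo M w x a -> lo M w x b -> lo M w x c -> False.
Proof.
move=> g u la lb lc; have := @good_le2 _ _ _ x _ g u.
by rewrite /= la lb lc => /(_ isT).
Qed.

(** The first vertex of [D] points to all its neighbours in [D], so it has at most two of them. *)
Lemma apex_base (D : seq V) s : s \in D ->
  (forall d, d \in D -> d != s -> exists a b c, [/\ uniq [:: a; b; c],
     {subset [:: a; b; c] <= D} & all (M d) [:: a; b; c]]) -> apex D s.
Proof.
move=> sD H w g Dw; have [h hD hmin] := seq_argmin (index^~ w) sD.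
case: (h =P s) => [<- //|/eqP hs].
have [a [b [c [u sub /and4P[ma mb mc _]]]]] := H h hD hs; exfalso.
have l z : z \in [:: a; b; c] -> M h z -> lo M w h z.
  by move=> /sub zD m; apply: index_lo => //; [exact: Dw|exact: Dw|exact: hmin].
by apply: (good_le2F g u); apply: l => //; rewrite !inE eqxx ?orbT.
Qed.

(** If [x] did not come first, [s] would, and it would point to [x], [p] and [q]. *)
Lemma apex_add (D : seq V) s p q x : uniq (x :: D) -> apex D s -> s \in D ->
  p \in D -> q \in D -> p != q -> M s p -> M s q -> M x s -> apex (x :: D) x.
Proof.
move=> /andP[xD uD] aD sD pD qD pq sp sq xs w g Dw.
have Dw' : {subset D <= w} by move=> a aD'; apply: Dw; rewrite inE aD' orbT.
have [h + hmin] := seq_argmin (index^~ w) (mem_head x D).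
rewrite inE => /predU1P[e|hD]; first by move=> d /hmin; rewrite e.
exfalso.
have smin d : d \in x :: D -> index s w <= index d w.
  by move=> /hmin; apply: leq_trans; exact: aD.
have l z : z \in x :: D -> M s z -> lo M w s z.
  move=> zD m; apply: index_lo => //; [exact: Dw'|exact: Dw|exact: smin].
apply: (@good_le2F w s x p q g).
- rewrite /= !inE negb_or pq !andbT; apply/andP.
  by split; apply: contraNneq xD => ->.
- by apply: l; rewrite ?mem_head // adj_sym.
- by apply: l => //; rewrite inE pD orbT.
- by apply: l => //; rewrite inE qD orbT.
Qed.

(** In a list ending with [X], no vertex of [D] precedes [s], so all of [D] lies in [X]. *)
Lemma apex_deep (D : seq V) s : uniq D -> apex D s -> deep (size D) s.
Proof.
move=> uD aD X uX sX sinX; have [u [w [g e Dw]]] := sX D.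
apply: uniq_leq_size => // d dD.
have := aD _ g Dw d dD; have := good_uniq g; rewrite cat_uniq.
case/and3P=> _ /hasPn dis _; rewrite -e !index_cat.
have := dis s; rewrite e sinX => /(_ isT) /= /negbTE ->.
case: ifP => [du|du _]; last by have := Dw d dD; rewrite mem_cat du.
rewrite leqNgt (_ : index d u < _) //; apply: leq_trans (leq_addr _ _).
by rewrite index_mem.
Qed.

(** Both out-edges of [s] are spent on [p] and [q]. *)
Lemma apex_forces (D : seq V) s p q w e : apex D s -> s \in D -> p \in D ->
  q \in D -> p != q -> M s p -> M s q -> good M w -> {subset D <= w} ->
  e \in w -> e \notin D -> M e s -> lo M w e s.
Proof.
move=> aD sD pD qD pq sp sq g Dw ew eD es.
have := lo_total ew (Dw s sD) es; case/orP=> // le; exfalso.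
apply: (@good_le2F w s e p q g) => //.
- rewrite /= !inE negb_or pq !andbT; apply/andP.
  by split; apply: contraNneq eD => ->.
- by apply: index_lo; rewrite ?Dw //; exact: aD.
- by apply: index_lo; rewrite ?Dw //; exact: aD.
Qed.

(* Starting from K_4 minus an edge with a vertex joined to its two
   non-adjacent vertices, the only vertex of degree at most two is the last
   one added. *)
Lemma ladder n : exists D s p q, [/\ uniq D, ssuff M D, n <= size D & apex D s]
  /\ [/\ s \in D, p \in D, q \in D, p != q & M s p /\ M s q].
Proof.
elim: n => [|n [D [s [p [q [[uD sD nD aD] [sinD pD qD pq [sp sq]]]]]]]]; last first.
  have [//|x [xD sx adj]] := @ssuff_add1 _ _ HM D [:: s; p] sD.
  have xs : M x s by rewrite adj // mem_head.
  have xp : M x p by rewrite adj // !inE eqxx orbT.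
  exists (x :: D), x, s, p; split; split; rewrite ?inE ?eqxx ?sinD ?pD ?orbT //.
  - by rewrite /= xD.
  - by apply: (apex_add (s := s) (p := p) (q := q)); rewrite /= ?xD.
  - exact: adj_neq sp.
have s0 : ssuff M [::].
  have [X' sX sub] := ssuff_extend HM [::].
  have [w' g' e'] := ssuff_good sX.
  apply: (@ssuff_suffix _ _ w'); rewrite cats0 //.
  by apply: ssuff_eq sX => x; rewrite e'.
have [//|a [an sa _]] := @ssuff_add1 _ _ HM [::] [::] s0.
have [//|b [bn sb adjb]] := @ssuff_add1 _ _ HM _ [:: a] sa.
have [//|c [cn sc adjc]] := @ssuff_add1 _ _ HM _ [:: a; b] sb.
have [//|d [dn sd adjd]] := @ssuff_add1 _ _ HM _ [:: a; b] sc.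
have [//|e [en se adje]] := @ssuff_add1 _ _ HM _ [:: c; d] sd.
have mba : M b a by rewrite adjb ?inE eqxx.
have mca : M c a by rewrite adjc !inE eqxx ?orbT.
have mcb : M c b by rewrite adjc !inE eqxx ?orbT.
have mda : M d a by rewrite adjd !inE eqxx ?orbT.
have mdb : M d b by rewrite adjd !inE eqxx ?orbT.
have mec : M e c by rewrite adje !inE eqxx ?orbT.
have med : M e d by rewrite adje !inE eqxx ?orbT.
have ue : uniq [:: e; d; c; b; a] by rewrite /= en dn cn bn.
have [ed ec eb ea] : [/\ e != d, e != c, e != b & e != a].
  by move: en; rewrite !inE !negb_or => /and5P[].
have [dc db da] : [/\ d != c, d != b & d != a].
  by move: dn; rewrite !inE !negb_or => /and4P[].
have [cb ca] : c != b /\ c != a by move: cn; rewrite !inE !negb_or => /and3P[].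
have ba : b != a by move: bn; rewrite !inE negb_or => /andP[].
exists [:: e; d; c; b; a], e, c, d; split; split => //;
  rewrite ?inE ?eqxx ?orbT // 1?eq_sym //.
apply: apex_base; first exact: mem_head.
have sub3 i j k : i \in [:: e; d; c; b; a] -> j \in [:: e; d; c; b; a] ->
    k \in [:: e; d; c; b; a] -> {subset [:: i; j; k] <= [:: e; d; c; b; a]}.
  move=> hi hj hk x; rewrite inE => /predU1P[-> //|].
  by rewrite inE => /predU1P[-> //|]; rewrite inE => /eqP ->.
move=> x; rewrite inE => /predU1P[->|]; first by rewrite eqxx.
rewrite !inE => /or4P[] /eqP -> _.
- exists e, a, b; split; last by rewrite /= mda mdb adj_sym med.
    by rewrite /= !inE negb_or ea eb eq_sym ba.
  by apply: sub3; rewrite !inE eqxx ?orbT.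
- exists e, a, b; split; last by rewrite /= mca mcb adj_sym mec.
    by rewrite /= !inE negb_or ea eb eq_sym ba.
  by apply: sub3; rewrite !inE eqxx ?orbT.
- exists a, c, d; split; last by rewrite /= mba ![M b _]adj_sym mcb mdb.
    by rewrite /= !inE negb_or ![a == _]eq_sym (negbTE ca) (negbTE da) eq_sym dc.
  by apply: sub3; rewrite !inE eqxx ?orbT.
- exists b, c, d; split; last by rewrite /= ![M a _]adj_sym mba mca mda.
    by rewrite /= !inE negb_or ![b == _]eq_sym (negbTE cb) (negbTE db) eq_sym dc.
  by apply: sub3; rewrite !inE eqxx ?orbT.
Qed.

(** Three neighbours of [t] cannot all be out-neighbours. *)
Lemma pick_lower w t (fs : seq V) : good M w -> t \in w -> {subset fs <= w} ->
  uniq fs -> size fs = 3 -> {in fs, forall f, M f t} ->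
  exists2 f, f \in fs & lo M w f t.
Proof.
move=> g tw fw uf sf mf; apply/hasP; apply/negPn/negP => /hasPn h.
suff : size fs <= 2 by rewrite sf.
apply: (good_le2 g (x := t)) => //; apply/allP => f fsf.
have mtf : M t f by rewrite adj_sym mf.
have := lo_total tw (fw f fsf) mtf.
by rewrite (negbTE (h f fsf)) orbF.
Qed.

(* If [e] were above [t], it would belong to the family over [{s, t}], which
   does not cross the family over [{s, z}]. *)
Lemma detect y w s t z e (fs as_ bs : seq V) : compat M y w ->
  s != t -> s != z -> t != z -> t \in w -> z \in w ->
  {in e :: fs ++ as_ ++ bs, forall x, lo M w x s} ->
  M e t -> {in fs, forall f, M f t} -> {in as_ ++ bs, forall a, M a z} ->
  uniq fs -> uniq as_ -> uniq bs -> size fs = 3 -> size as_ = 3 ->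
  size bs = 3 -> (forall f a b, f \in fs -> a \in as_ -> b \in bs ->
     cross y e f a b = true) ->
  lo M w t e.
Proof.
move=> [g c] st sz tz tw zw ls et ft az uf ua ub sf sa sb cr.
have ew : e \in w by apply: lo_meml (ls e _); rewrite mem_head.
have := lo_total ew tw et; case/orP => // le.
have [f ff lf] : exists2 f, f \in fs & lo M w f t.
  apply: pick_lower => // x xf; apply: lo_meml (ls x _).
  by rewrite inE !mem_cat xf orbT.
have [a aa la] : exists2 a, a \in as_ & lo M w a z.
  apply: pick_lower => // [x xa|x xa]; last by apply: az; rewrite mem_cat xa.
  by apply: lo_meml (ls x _); rewrite inE !mem_cat xa !orbT.
have [b bb lb] : exists2 b, b \in bs & lo M w b z.
  apply: pick_lower => // [x xb|x xb]; last by apply: az; rewrite mem_cat xb orbT.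
  by apply: lo_meml (ls x _); rewrite inE !mem_cat xb !orbT.
have := cr f a b ff aa bb.
rewrite (c s t z) //; apply: ls; rewrite ?inE ?eqxx // !mem_cat.
- by rewrite ff orbT.
- by rewrite aa !orbT.
- by rewrite bb !orbT.
Qed.

Lemma majority (T : eqType) (f : pred T) (l : seq T) : uniq l -> size l = 5 ->
  exists b l', [/\ uniq l', size l' = 3, {subset l' <= l} &
    {in l', forall x, f x = b}].
Proof.
move=> ul sl; have := count_predC f l; rewrite sl => e.
suff [b nb] : exists b, 3 <= count (fun x => f x == b) l.
  exists b, (take 3 [seq x <- l | f x == b]); split.
  - exact/take_uniq/filter_uniq.
  - by rewrite size_takel // size_filter.
  - by move=> x /mem_take; rewrite mem_filter => /andP[].
  - by move=> x /mem_take; rewrite mem_filter => /andP[/eqP].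
have [nb|nb] := leqP 3 (count f l); [exists true|exists false].
  by rewrite (eq_count (a2 := f)) // => x /=; rewrite eqb_id.
rewrite (eq_count (a2 := predC f)); first by lia.
by move=> x /=; rewrite eqbF_neg.
Qed.

(** Of 21 points, 11 lie on one side of [e2]. With [e1] the sixth of these, the pair [{e1, e2}]
    separates five points before [e1] from five after; [majority] later keeps three of each five. *)
Lemma middle y (E : seq V) e2 :
  (forall x, ~~ y x x) -> (forall a b c, y a b -> y b c -> y a c) ->
  (forall a b, a != b -> y a b || y b a) ->
  uniq E -> size E = 21 -> exists e1 (as_ bs : seq V),
    [/\ e1 \in E, {subset as_ <= [seq x <- E | x != e1]},
        {subset bs <= [seq x <- E | x != e1]}, uniq as_ & uniq bs] /\
    [/\ size as_ = 5, size bs = 5 & forall a b, a \in as_ -> b \in bs ->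
      cross y e1 e2 a b = true].
Proof.
move=> yirr ytr ytot uE sE.
have [b nb] : exists b, 11 <= count (fun x => y e2 x == b) E.
  have := count_predC (y e2) E; rewrite sE => e.
  have [nb|nb] := leqP 11 (count (y e2) E); [exists true|exists false].
    by rewrite (eq_count (a2 := y e2)) // => x /=; rewrite eqb_id.
  rewrite (eq_count (a2 := predC (y e2))); first by lia.
  by move=> x /=; rewrite eqbF_neg.
pose leT a c := ~~ y c a.
have letot : total leT.
  move=> a c; rewrite /leT -negb_and; apply/negP => /andP[h h'].
  by have := ytr _ _ _ h h'; rewrite (negbTE (yirr _)).
have letr : transitive leT.
  move=> c a d; rewrite /leT => ac cd; apply/negP => da.
  case: (c =P d) => [e|/eqP ne]; first by rewrite e da in ac.
  have := ytot _ _ ne; rewrite (negbTE cd) orbF => yce.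
  by have := ytr _ _ _ yce da; rewrite (negbTE ac).
set S := sort leT [seq x <- E | y e2 x == b].
have sS : 11 <= size S by rewrite size_sort size_filter.
have uS : uniq S by rewrite sort_uniq filter_uniq.
have pS : pairwise leT S by rewrite -sorted_pairwise // sort_sorted.
have SE x : x \in S -> x \in E /\ y e2 x = b.
  by rewrite mem_sort mem_filter => /andP[/eqP].
have eS : S = take 5 S ++ nth e2 S 5 :: drop 6 S.
  by rewrite -(drop_nth e2) ?cat_take_drop //; apply: leq_trans sS.
move: uS pS; rewrite eS; set e1 := nth e2 S 5.
rewrite cat_uniq pairwise_cat => /and3P[uA /hasPn dis /= /andP[e1B uB]].
case/and3P=> /allrelP AB pA /andP[/allP eB pB].
have e1S : e1 \in S by rewrite mem_nth //; apply: leq_trans sS.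
have SE' x : x \in S -> x != e1 -> x \in [seq x <- E | x != e1].
  by move=> /SE[xE _] ne; rewrite mem_filter ne.
have Ane x : x \in take 5 S -> x != e1.
  by apply: contraTneq => ->; apply: dis; rewrite mem_head.
have Bne x : x \in take 5 (drop 6 S) -> x != e1.
  by move/mem_take; apply: contraTneq => ->.
have AS x : x \in take 5 S -> x \in S by exact: mem_take.
have BS x : x \in take 5 (drop 6 S) -> x \in S by move/mem_take/mem_drop.
exists e1, (take 5 S), (take 5 (drop 6 S)); split; split.
- by have [] := SE _ e1S.
- by move=> x xA; apply: SE'; [exact: AS|exact: Ane].
- by move=> x xB; apply: SE'; [exact: BS|exact: Bne].
- exact: uA.
- exact: take_uniq.
- by rewrite size_takel //; apply: leq_trans sS.
- by rewrite size_takel // size_drop; lia.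
- move=> a c aA cB; rewrite /cross.
  have [_ ->] := SE _ (AS _ aA); have [_ ->] := SE _ (BS _ cB).
  have /negbTE -> : ~~ y e1 a by apply: (AB a e1) => //; exact: mem_head.
  have := ytot _ _ (Bne _ cB); have := eB c (mem_take cB).
  by rewrite /leT => /negbTE -> /= ->; case: (b).
Qed.

End Forcing.

(** * Chains of detected edges *)

Section Reserve.
Variables (V : countType) (M : sgraph V).
Implicit Types (w l r : seq V) (k : V -> nat).

(* [k x] counts further edges going down from [x], outside the list. *)
Fixpoint reserve k w : bool :=
  if w is x :: w' then [&& x \notin w', count (M x) w' + k x <= 2 & reserve k w']
  else true.

Lemma reserve0 w : reserve (fun=> 0) w = good M w.
Proof. by elim: w => //= x w ->; rewrite addn0. Qed.

(** The room [k'] pays for the edges from [l] into [r] and for what [k] still promises. *)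
Lemma reserve_cat k k' l r : reserve k' l -> reserve k r -> uniq (l ++ r) ->
  {in l, forall x, count (M x) r + k x <= k' x} -> reserve k (l ++ r).
Proof.
move=> + kr; elim: l => //= x l IH /and3P[xl cx kl] /andP[xlr ulr] h.
rewrite xlr IH // ?andbT; last by move=> z zl; apply: h; rewrite inE zl orbT.
rewrite count_cat -addnA; apply: leq_trans cx; rewrite leq_add2l.
exact/h/mem_head.
Qed.

Lemma reserve_uniq k w : reserve k w -> uniq w.
Proof. by elim: w => //= x w IH /and3P[-> _ /IH]. Qed.

Lemma reserve_indep w : uniq w -> independent M w -> reserve (fun=> 2) w.
Proof.
elim: w => //= x w IH /andP[-> uw] ind.
rewrite IH // ?andbT => [|a b aw bw]; last by apply: ind; rewrite inE ?aw ?bw orbT.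
rewrite (@eq_in_count _ _ pred0) ?count_pred0 // => z zw.
by apply: ind; rewrite inE ?eqxx ?zw ?orbT.
Qed.

Lemma count_adj1 w x t : uniq w -> (forall z, z \in w -> M x z -> z = t) ->
  count (M x) w <= (M x t).
Proof.
move=> uw h; case mxt: (M x t); last first.
  rewrite (@eq_in_count _ _ pred0) ?count_pred0 // => z zw /=.
  by apply/negP => m; rewrite -(h z zw m) m in mxt.
apply: leq_trans (_ : count (pred1 t) w <= 1); last first.
  by rewrite count_uniq_mem //; case: (t \in w).
rewrite -!size_filter; apply: uniq_leq_size; first exact: filter_uniq.
by move=> z; rewrite !mem_filter /= => /andP[m zw]; rewrite zw (h z zw m) eqxx.
Qed.

Lemma count_adj0 w x : (forall z, z \in w -> M x z = false) ->
  count (M x) w = 0.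
Proof. by move=> h; rewrite (@eq_in_count _ _ pred0) ?count_pred0. Qed.

Lemma edges_sorted w : sorted M w -> size w <= (edges M w).+1.
Proof.
case: w => //= x w; elim: w x => //= z w IH x /andP[m /IH h].
by rewrite m; lia.
Qed.

Lemma edges_le w : good M w -> edges M w <= 2 * size w.
Proof. by elim: w => //= x w IH /and3P[_ c /IH]; lia. Qed.

Lemma matching_good w w' : good M w -> matching M w w' -> uniq w' -> good M w'.
Proof.
elim: w w' => [|x w IH] [|x' w'] //= /and3P[_ c g] [e m] /andP[-> u].
rewrite (IH w') // andbT /=; apply: leq_trans c.
have -> : count (M x') w' = count id (map (M x') w') by rewrite count_map.
by rewrite -e count_map.
Qed.

End Reserve.

Section Tower.
Variables (V : countType) (M : sgraph V) (y : rel V).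
Hypothesis HM : fraisse_limit_C1 M.
Hypothesis yirr : forall x, ~~ y x x.
Hypothesis ytr : forall a b c, y a b -> y b c -> y a c.
Hypothesis ytot : forall a b, a != b -> y a b || y b a.

Variables (Q : seq V) (s p q : V).
Hypotheses (aQ : apex M Q s) (sQ : s \in Q) (pQ : p \in Q) (qQ : q \in Q)
  (pq : p != q) (sp : M s p) (sq : M s q).

(** The revealed out-edge of [x], which may depend on [w]. Its end [e] is outside [K], which leaves
    [x] one out-edge for the attached set and [K]; and [e] is [s] or points to [s], so [x] reaches
    [s] in two steps. *)
Definition lit (N K D : seq V) x := forall w, compat M y w ->
  {subset N ++ D <= w} ->
  exists2 e, (e \in N) || (e == s) & [/\ e \notin K, lo M w x e &
    (e = s) \/ lo M w e s].

(** As [fs] lies in one cut of [E1] and [as_], [bs] separate [e1] from [e2], one of [e1], [e2] is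
    separated from [fs], and [detect] applies to it. *)
Lemma detect_fork D t z1 e1 e2 (as_ bs fs E1 : seq V) :
  uniq D -> {subset Q <= D} -> s \in D -> t \in D -> z1 \in D ->
  e1 \in D -> e2 \in D -> {subset fs <= D} -> {subset E1 <= D} ->
  {in e1 :: e2 :: fs ++ E1, forall x, x \notin Q /\ M x s} ->
  s != t -> s != z1 -> t != z1 -> M e1 t -> M e2 t -> {in fs, forall f, M f t} ->
  {in E1, forall a, M a z1} ->
  {subset as_ <= E1} -> {subset bs <= E1} -> uniq as_ -> uniq bs ->
  size as_ = 5 -> size bs = 5 -> uniq fs -> size fs = 3 ->
  (forall a b, a \in as_ -> b \in bs -> cross y e1 e2 a b = true) ->
  (forall x a b, x \in E1 -> a \in fs -> b \in fs -> y a x = y b x) ->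
  (forall w, compat M y w -> {subset D <= w} -> lo M w t e1) \/
  (forall w, compat M y w -> {subset D <= w} -> lo M w t e2).
Proof.
move=> uD QD sD tD zD e1D e2D fD ED QF st sz tz m1 m2 mf mE aE bE ua ub sa sb.
move=> uf sf cr mono.
have [f0 f0f] : exists f0, f0 \in fs.
  by case: fs sf {fD QF mf uf mono} => // f0 fs _; exists f0; rewrite mem_head.
have [A [as' [ua' sa' asub ca]]] := majority (fun a => y e1 a (+) y f0 a) ua sa.
have [B [bs' [ub' sb' bsub cb]]] := majority (fun a => y e1 a (+) y f0 a) ub sb.
have aE' x : x \in as' ++ bs' -> x \in E1.
  by rewrite mem_cat => /orP[/asub/aE|/bsub/bE].
have ls e w : e \in [:: e1; e2] -> compat M y w -> {subset D <= w} ->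
    {in e :: fs ++ as' ++ bs', forall x, lo M w x s}.
  move=> ee [g _] Dw x xin.
  have : x \in e1 :: e2 :: fs ++ E1.
    move: xin; rewrite inE mem_cat => /or3P[/eqP ->|xf|/aE' xE].
    - by move: ee; rewrite !inE => /orP[] ->; rewrite ?orbT.
    - by rewrite !inE mem_cat xf !orbT.
    - by rewrite !inE mem_cat xE !orbT.
  move=> xin'; have [xQ xs] := QF x xin'.
  apply: (apex_forces aQ sQ pQ qQ) => //; first by move=> d /QD/Dw.
  apply: Dw; move: xin'; rewrite !inE mem_cat.
  by case/or4P=> [/eqP ->|/eqP ->|/fD|/ED].
have sgn f x : f \in fs -> x \in E1 -> y f x = y f0 x.
  by move=> ff xE; exact: mono.
have i1 : e1 \in [:: e1; e2] by rewrite mem_head.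
have i2 : e2 \in [:: e1; e2] by rewrite !inE eqxx orbT.
have mE' : {in as' ++ bs', forall a, M a z1} by move=> a /aE'/mE.
(* [A (+) B] is the value of [cross y e1 f a b] on the majorities; adding [cross y e1 e2 a b] gives
   that of [cross y e2 f a b]. *)
case: (boolP (A (+) B)) => AB; [left|right] => w cw Dw.
  apply: (detect cw st sz tz (Dw _ tD) (Dw _ zD) (ls _ _ i1 cw Dw) m1 mf mE' uf
    ua' ub' sf sa' sb').
  move=> f a b ff aa bb; rewrite /cross !(sgn f) // ?aE' ?mem_cat ?aa ?bb ?orbT //.
  by rewrite ca // cb.
apply: (detect cw st sz tz (Dw _ tD) (Dw _ zD) (ls _ _ i2 cw Dw) m2 mf mE' uf
  ua' ub' sf sa' sb').
move=> f a b ff aa bb; have := cr a b (asub _ aa) (bsub _ bb).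
rewrite /cross !(sgn f) // ?aE' ?mem_cat ?aa ?bb ?orbT //.
move: (ca a aa) (cb b bb) AB => <- <-.
by case: (y e1 a) (y f0 a) (y e2 a) (y e1 b) (y f0 b) (y e2 b) =>
  [] [] [] [] [] [].
Qed.

(* [K] alternates between the vertices of [ps], to each of which one more
   vertex can be attached from above, and in-neighbours of [s]. The
   arrangement [N'] is the one used when the attached set comes first; the top
   [tau] has room for one edge more, by which the chain is prolonged. *)
Definition chain_over D m N tau (K ps : seq V) :=
  [/\ [/\ uniq (N ++ D), ssuff M (N ++ D),
         forall x d, x \in N -> d \in D -> M x d -> d = s,
         tau \in N & {subset K <= N}],
      [/\ uniq K, size K = 2 * m, sorted M K & head tau K = tau],
      [/\ uniq ps, size ps = m & {subset ps <= K}],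
      exists2 N', N' =i N &
        reserve M (fun x => M x s + (x \in ps) + (x == tau)) N' &
      {in K, forall x, lit N K D x}].

Lemma chain0 D : uniq D -> ssuff M D -> s \in D ->
  exists N tau K ps, chain_over D 0 N tau K ps.
Proof.
move=> uD sD sinD.
have [//|v [vD sv adj]] := @ssuff_add1 _ _ HM D [::] sD.
exists [:: v], v, [::], [::]; split; [split|split|split| |] => //=.
- by rewrite vD.
- by move=> x d; rewrite inE => /eqP -> dD; rewrite adj.
- exact: mem_head.
- by exists [:: v] => //=; rewrite eqxx andbT (adj s sinD).
Qed.

(** A new vertex [t] is joined to the tops of two chains through [e1] and [e2], and receives a
    family [fs] over [{s, t}]. One of its two edges is revealed and [t] prolongs the chain of the
    other one; as the order decides which, two chains are needed. *)
Lemma chainS D m N1 tau1 K1 ps1 N2 tau2 K2 ps2 : uniq D -> ssuff M D ->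
  {subset Q <= D} ->
  chain_over D m N1 tau1 K1 ps1 -> chain_over (N1 ++ D) m N2 tau2 K2 ps2 ->
  exists N tau K ps, chain_over D m.+1 N tau K ps.
Proof.
move=> uD sD QD.
move=> [[u1 s1 sep1 t1 KN1] [uK1 sK1 path1 hd1] [up1 sps1 pK1] [N1' eN1 r1] l1].
move=> [[u2 s2 sep2 t2 KN2] [uK2 sK2 path2 hd2] [up2 sps2 pK2] [N2' eN2 r2] l2].
have sinD : s \in D := QD _ sQ.
have dN1 x : x \in N1 -> x \in D = false.
  move: u1; rewrite cat_uniq => /and3P[_ /hasPn dis _] xN.
  by apply/negbTE; apply: contraL xN => /dis.
have dN2 x : x \in N2 -> x \in N1 ++ D = false.
  move: u2; rewrite cat_uniq => /and3P[_ /hasPn dis _] xN.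
  by apply/negbTE; apply: contraL xN => /dis.
set D2 := N2 ++ N1 ++ D in u2 s2.
have D2s : s \in D2 by rewrite !mem_cat sinD !orbT.
have D2t1 : tau1 \in D2 by rewrite !mem_cat t1 !orbT.
have D2t2 : tau2 \in D2 by rewrite !mem_cat t2.
have sub2 (a b : V) (B : seq V) : a \in B -> b \in B -> {subset [:: a; b] <= B}.
  by move=> aB bB x; rewrite !inE => /orP[] /eqP ->.
have [E1 [sE1 uE1 ssE1 att1 ind1]] :=
  pool HM 21 s2 u2 (sub2 _ _ _ D2s D2t1) isT.
have dE1 x : x \in E1 -> x \in D2 = false.
  move: uE1; rewrite cat_uniq => /and3P[_ /hasPn dis _] xE.
  by apply/negbTE; apply: contraL xE => /dis.
have uE : uniq E1 by move: uE1; rewrite cat_uniq => /and3P[].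
set D3 := E1 ++ D2 in uE1 ssE1.
have [//|e2 [e2n se2 adj2]] := @ssuff_add1 _ _ HM D3 [:: s; tau2] ssE1.
have [e1 [as_ [bs [[e1E asE bsE ua ub] [sa sb cr]]]]] :=
  middle e2 yirr ytr ytot uE sE1.
set D4 := e2 :: D3 in se2.
have [//|t [tn st adjt]] := @ssuff_add1 _ _ HM D4 [:: e1; e2] se2.
set D5 := t :: D4 in st.
have u5 : uniq D5 by rewrite /= tn e2n.
have D25 x : x \in D2 -> x \in D5.
  by move=> xD; rewrite [x \in D5]inE [x \in D4]inE [x \in D3]mem_cat xD !orbT.
have D5t : t \in D5 by rewrite mem_head.
have [fs [[sfs ufs ssfs attf indf] mono]] :=
  mono_pool HM y 3 st u5 (sub2 _ _ _ (D25 _ D2s) D5t) isT.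
have uf : uniq fs by move: ufs; rewrite cat_uniq => /and3P[].
have df x : x \in fs -> x \in D5 = false.
  move: ufs; rewrite cat_uniq => /and3P[_ /hasPn dis _] xE.
  by apply/negbTE; apply: contraL xE => /dis.
set D6 := fs ++ D5 in ufs ssfs.
pose N := fs ++ t :: e2 :: E1 ++ N2 ++ N1.
have eND : N ++ D = D6 by rewrite /N /D6 /D5 /D4 /D3 /D2 -!catA /= -!catA.
have uND : uniq (N ++ D) by rewrite eND.
have dN x : x \in N -> x \in D = false.
  move: uND; rewrite cat_uniq => /and3P[_ /hasPn dis _] xE.
  by apply/negbTE; apply: contraL xE => /dis.
have sN : s \in N = false by apply/negbTE/negP => /dN; rewrite sinD.
have fN x : x \in fs -> x \in N by rewrite /N mem_cat => ->.
have tN : t \in N by rewrite /N mem_cat mem_head orbT.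
have e2N : e2 \in N by rewrite /N mem_cat !inE eqxx !orbT.
have EN x : x \in E1 -> x \in N by rewrite /N !(mem_cat, inE) => ->; rewrite !orbT.
have N2N x : x \in N2 -> x \in N by rewrite /N !(mem_cat, inE) => ->; rewrite !orbT.
have N1N x : x \in N1 -> x \in N by rewrite /N !(mem_cat, inE) => ->; rewrite !orbT.
have ne_s x : x \in N -> x == s = false.
  by move=> xN; apply/negbTE; apply: contraTneq xN => ->; rewrite sN.
have E3 x : x \in E1 -> x \in D3 by move=> xE; rewrite [x \in D3]mem_cat xE.
have D23 x : x \in D2 -> x \in D3.
  by move=> xD; rewrite [x \in D3]mem_cat xD orbT.
have N1D2 x : x \in N1 -> x \in D2 by move=> xN; rewrite !mem_cat xN orbT.
have N2D2 x : x \in N2 -> x \in D2 by move=> xN; rewrite mem_cat xN.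
have D34 x : x \in D3 -> x \in D4.
  by move=> xD; rewrite [x \in D4]inE xD orbT.
have D45 x : x \in D4 -> x \in D5.
  by move=> xD; rewrite [x \in D5]inE xD orbT.
have neq x z (B : seq V) : x \in B = false -> z \in B -> x == z = false.
  by move=> xB zB; apply/negbTE; apply: contraFneq xB => ->.
have tnF : t \in D4 = false := negbTE tn.
have e2F : e2 \in D3 = false := negbTE e2n.
have te1 : M t e1 by rewrite adjt ?mem_head // D34 // E3.
have te2 : M t e2 by rewrite adjt ?mem_head // !inE eqxx orbT.
have e1t1 : M e1 tau1 by rewrite att1 // !inE eqxx orbT.
have e2t2 : M e2 tau2 by rewrite adj2 ?D23 // !inE eqxx orbT.
have e1s : M e1 s by rewrite att1 // mem_head.
have e2s : M e2 s by rewrite adj2 ?D23 // mem_head.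
have Mt x : x \in D4 -> M x t = (x == e1) || (x == e2).
  by move=> xD; rewrite adj_sym adjt // !inE.
have Me2 x : x \in D2 -> M x e2 = (x == s) || (x == tau2).
  by move=> xD; rewrite adj_sym adj2 ?D23 // !inE.
have Me1 x : x \in D2 -> M x e1 = (x == s) || (x == tau1).
  by move=> xD; rewrite adj_sym att1 // !inE.
have sep x d : x \in N -> d \in D -> M x d -> d = s.
  move=> xN dD mx; have dD2 : d \in D2 by rewrite mem_cat [d \in N1 ++ D]mem_cat dD !orbT.
  have ned z : z \in N -> d == z = false.
    by move=> zN; apply/negbTE; apply: contraTneq dD => ->; rewrite dN.
  move: xN; rewrite /N !(mem_cat, inE) => /orP[xf|].
    by move: mx; rewrite attf ?D25 // !inE [d == t]ned // orbF => /eqP.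
  case/or4P=> [/eqP ex|/eqP ex|xE|].
  - by move: mx; rewrite ex adjt ?D34 ?D23 // !inE !ned // EN.
  - by move: mx; rewrite ex adj2 ?D23 // !inE [d == tau2]ned ?N2N // orbF => /eqP.
  - by move: mx; rewrite att1 // !inE [d == tau1]ned ?N1N // orbF => /eqP.
  - case/orP=> xN; last exact: (sep1 x).
    by apply: (sep2 x) => //; rewrite mem_cat dD orbT.
have forced w x : compat M y w -> {subset N ++ D <= w} -> x \in N -> M x s ->
    lo M w x s.
  move=> [g _] Nw xN xs; have Dw a : a \in D -> a \in w.
    by move=> aD; apply: Nw; rewrite mem_cat aD orbT.
  apply: (apex_forces aQ sQ pQ qQ) => //; first by move=> a /QD/Dw.
    by apply: Nw; rewrite mem_cat xN.
  by apply/negP => /QD; rewrite dN.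
have fork : (forall w, compat M y w -> {subset N ++ D <= w} -> lo M w t e1) \/
    (forall w, compat M y w -> {subset N ++ D <= w} -> lo M w t e2).
  have ND x : x \in N -> x \in N ++ D by move=> xN; rewrite mem_cat xN.
  apply: (@detect_fork (N ++ D) t tau1 e1 e2 as_ bs fs E1) => //.
  - by move=> x /QD; rewrite mem_cat orbC => ->.
  - by rewrite mem_cat sinD orbT.
  - exact: ND.
  - exact/ND/N1N.
  - exact/ND/EN.
  - exact: ND.
  - by move=> x /fN/ND.
  - by move=> x /EN/ND.
  - move=> x; rewrite !inE mem_cat => h.
    have xN : x \in N by case/or4P: h => [/eqP ->|/eqP ->|/fN|/EN] //; exact: EN.
    split; first by apply/negP => /QD; rewrite dN.
    case/or4P: h => [/eqP ->|/eqP ->|xf|xE] //.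
      by rewrite attf ?D25 // mem_head.
    by rewrite att1 // mem_head.
  - by rewrite eq_sym ne_s.
  - by rewrite eq_sym ne_s // N1N.
  - by rewrite (neq _ _ _ tnF) // D34 // D23.
  - by rewrite adj_sym.
  - by rewrite adj_sym.
  - by move=> f ff; rewrite attf // !inE eqxx orbT.
  - by move=> a aE; rewrite att1 // !inE eqxx orbT.
  - by move=> x /asE; rewrite mem_filter => /andP[].
  - by move=> x /bsE; rewrite mem_filter => /andP[].
  - move=> x a b xE af bf; have xD5 : x \in D5 by apply/D45/D34/E3.
    by have [] := mono x a b xD5 af bf.
(* The chain continues from [t] through [eh]; [eo] is the end of the revealed edge. *)
have build eh eo Nh Dh Kh psh tauh :
    eh \in N -> eo \in N -> eh \in D4 -> eo \in D4 -> eo != eh ->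
    M t eh -> M eh tauh -> M eh s -> M eo s ->
    {subset Nh <= N} -> {subset Nh ++ Dh <= N ++ D} -> {subset Nh <= D2} ->
    eh \notin Nh -> eo \notin Nh ->
    {subset Kh <= Nh} -> uniq Kh -> size Kh = 2 * m -> sorted M Kh ->
    head tauh Kh = tauh -> uniq psh -> size psh = m -> {subset psh <= Kh} ->
    {in Kh, forall x, lit Nh Kh Dh x} ->
    (forall x, x \in N1 -> (x \in psh) <= (x \in ps1)) ->
    (forall x, x \in N2 -> (x \in psh) <= (x \in ps2)) ->
    (forall w, compat M y w -> {subset N ++ D <= w} -> lo M w t eo) ->
    exists N tau K ps, chain_over D m.+1 N tau K ps.
  move=> ehN eoN eh4 eo4 neh teh eht ehs eos sNh sNhD Nh2 ehNh eoNh KNh uKh sKh.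
  move=> pathh hdh uph sph pKh lh w1 w2 teo.
  have tNh : t \in Nh = false.
    by apply/negbTE/negP => /Nh2/D23/D34; rewrite tnF.
  have tKh : t \in Kh = false by apply/negbTE/negP => /KNh; rewrite tNh.
  have ehKh : eh \in Kh = false by apply/negbTE; apply: contra ehNh => /KNh.
  have eoKh : eo \in Kh = false by apply/negbTE; apply: contra eoNh => /KNh.
  exists N, t, (t :: eh :: Kh), (t :: psh); split; [split|split|split| |] => //.
  - by rewrite eND.
  - by move=> x; rewrite !inE => /or3P[/eqP ->|/eqP ->|/KNh/sNh].
  - by rewrite /= !inE tKh ehKh (neq _ _ _ tnF).
  - by rewrite /= sKh mulnS.
  - rewrite /= teh; move: pathh hdh; case: (Kh) => //= k l pk kt.
    by rewrite pk kt eht.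
  - by rewrite /= uph andbT; apply/negP => /pKh; rewrite tKh.
  - by rewrite /= sph.
  - by move=> x; rewrite !inE => /predU1P[->|/pKh ->]; rewrite ?eqxx ?orbT.
  (* Listing [t] last reverses its edges to [e1] and [e2]. Both its out-edges become free, one for
     its place in [psh] and one as the new top, while [tau1] and [tau2] spend their spare edges on
     [e1] and [e2]. *)
  - exists (fs ++ [seq x <- E1 | x != e1] ++ N2' ++ N1' ++ [:: e2; e1; t]).
      move=> x; rewrite /N !(mem_cat, inE, mem_filter) eN1 eN2.
      case: (x =P e1) => [->|_] /=; first by rewrite e1E !orbT.
      by case: (x \in fs) (x == t) (x == e2) (x \in E1) (x \in N1) (x \in N2) =>
        [] [] [] [] [] [].
    set k := fun x => _.
    have kx x : x != t -> k x = M x s + (x \in psh).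
      by move=> xt; rewrite /k (negbTE xt) inE (negbTE xt) /= addn0.
    have ph x : x \in D2 = false -> x \in psh = false.
      by move=> xD; apply/negbTE/negP => /pKh/KNh/Nh2; rewrite xD.
    have tD2 : t \in D2 = false by apply/negbTE/negP => /D23/D34; rewrite tnF.
    have net x : x \in D4 -> x != t.
      by move=> xD; apply: contraTneq xD => ->; rewrite tnF.
    have e1D2 := dE1 _ e1E.
    have e2D2 : e2 \in D2 = false by apply/negbTE/negP => /D23; rewrite e2F.
    have e12 : e2 != e1 by rewrite (neq _ _ _ e2F) // E3.
    have Me21 : M e2 e1 = false.
      rewrite adj2 ?E3 // !inE ne_s ?EN // [e1 == tau2](neq _ _ D2) //.
    have e1D4 : e1 \in D4 by apply/D34/E3.
    have e2D4 : e2 \in D4 by rewrite mem_head.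
    have rb : reserve M k [:: e2; e1; t].
      have k1 : k e1 = 1 by rewrite kx ?net // e1s ph.
      have k2 : k e2 = 1 by rewrite kx ?net // e2s ph.
      have kt : k t = 2.
        rewrite /k eqxx mem_head adjt ?D34 ?D23 // !inE ![s == _]eq_sym.
        by rewrite !ne_s // EN.
      rewrite /= !inE negb_or e12 /= Me21 !Mt // !eqxx orbT k1 k2 kt.
      by rewrite !net.
    have neD z x : z \in D2 = false -> x \in D2 -> x == z = false.
      by move=> zD xD; rewrite eq_sym (neq _ _ _ zD).
    have ub3 : uniq [:: e2; e1; t] := reserve_uniq rb.
    have r1b : reserve M k (N1' ++ [:: e2; e1; t]).
      apply: (reserve_cat r1 rb).
        rewrite cat_uniq (reserve_uniq r1) ub3 andbT; apply/hasPn => x.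
        rewrite !inE /= eN1; apply: contraL => /N1D2 xD; rewrite !negb_or.
        by apply/and3P; split; apply: contraTneq xD => ->; rewrite ?e2D2 ?e1D2 ?tD2.
      move=> x; rewrite eN1 => xN1; have xD2 := N1D2 _ xN1.
      have x2 : x == tau2 = false.
        by apply: (neq _ _ N2) => //; apply/negbTE/negP => /dN2; rewrite mem_cat xN1.
      rewrite /= Me2 // Me1 // Mt ?D34 ?D23 // ne_s ?N1N // x2.
      rewrite (neD e1) // (neD e2) //.
      rewrite kx ?net ?D34 ?D23 //= !addn0 add0n.
      by rewrite addnC -!addnA !leq_add2l leq_add2r; exact: w1.
    have r2b : reserve M k (N2' ++ N1' ++ [:: e2; e1; t]).
      apply: (reserve_cat r2 r1b).
        rewrite cat_uniq (reserve_uniq r2) (reserve_uniq r1b) andbT.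
        apply/hasPn => x; rewrite !(inE, mem_cat) /= eN1 eN2.
        apply: contraL => xN; have xD := N2D2 _ xN; rewrite !negb_or.
        apply/and4P; split; try by apply: contraTneq xD => ->;
          rewrite ?e2D2 ?e1D2 ?tD2.
        by have := dN2 _ xN; rewrite mem_cat => /negbT; rewrite negb_or => /andP[].
      move=> x; rewrite eN2 => xN2; have xD2 := N2D2 _ xN2.
      have x1 : x == tau1 = false.
        have t1D : tau1 \in N1 ++ D by rewrite mem_cat t1.
        exact: neq (dN2 _ xN2) t1D.
      rewrite count_cat count_adj0 => [|z]; last first.
        rewrite eN1 => zN1; apply/negP => mz.
        have zD : z \in N1 ++ D by rewrite mem_cat zN1.
        by have := N1N z zN1; rewrite (sep2 x z xN2 zD mz) sN.
      rewrite /= Me2 // Me1 // Mt ?D34 ?D23 // ne_s ?N2N // x1.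
      rewrite (neD e1) // (neD e2) //.
      rewrite kx ?net ?D34 ?D23 //= ?orbF !addn0 !add0n.
      by rewrite addnC -!addnA !leq_add2l leq_add2r; exact: w2.
    set R2 := N2' ++ N1' ++ _ in r2b *.
    have R2m x : x \in R2 -> [|| x \in D2, x == e2, x == e1 | x == t].
      rewrite [x \in R2]mem_cat [x \in N1' ++ _]mem_cat eN1 eN2.
      case/or3P=> [/N2D2 ->|/N1D2 ->|] //.
      by rewrite !inE => ->; rewrite orbT.
    have R2s x : x \in R2 -> x != s.
      rewrite [x \in R2]mem_cat [x \in N1' ++ _]mem_cat eN1 eN2 => h.
      rewrite ne_s //; case/or3P: h => [/N2N|/N1N|] //.
      by rewrite !inE => /or3P[] /eqP -> //; exact: EN.
    have rE : reserve M k ([seq x <- E1 | x != e1] ++ R2).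
      apply: (reserve_cat (reserve_indep _ _) r2b).
      - exact: filter_uniq.
      - by move=> a b; rewrite !mem_filter => /andP[_ aE] /andP[_ bE]; exact: ind1.
      - rewrite cat_uniq filter_uniq // (reserve_uniq r2b) andbT /=.
        apply/hasPn => x /R2m h; rewrite /= mem_filter negb_and negbK.
        case/or4P: h => [xD|/eqP ->|/eqP ->|/eqP ->].
        + by apply/orP; right; apply/negP => /dE1; rewrite xD.
        + by apply/orP; right; apply/negP => /E3; rewrite e2F.
        + by rewrite eqxx.
        + by apply/orP; right; apply/negP => /E3/D34; rewrite tnF.
      - move=> x; rewrite mem_filter => /andP[xe1 xE].
        have xD4 := D34 _ (E3 _ xE).
        rewrite kx ?net // att1 // mem_head ph ?dE1 // addn0 addn1 ltnS.
        apply: leq_trans (count_adj1 (t := tau1) (reserve_uniq r2b) _) _.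
          move=> z zR mz; have := R2s z zR; have := R2m z zR.
          case/or4P=> [zD|/eqP ez|/eqP ez|/eqP ez].
          + by move: mz; rewrite att1 // !inE => /orP[/eqP ->|/eqP //]; rewrite eqxx.
          + move: mz; rewrite ez adj_sym adj2 ?E3 // !inE ne_s ?EN //.
            by rewrite [x == tau2](neq _ _ D2) // dE1.
          + by move: mz; rewrite ez ind1.
          + move: mz; rewrite ez Mt // (negbTE xe1) [x == e2]eq_sym.
            by rewrite (neq _ _ D3) // E3.
        by case: (M x tau1).
    apply: (reserve_cat (reserve_indep uf indf) rE).
      rewrite cat_uniq uf (reserve_uniq rE) andbT; apply/hasPn => x.
      rewrite mem_cat mem_filter => h; apply/negP => /df.
      case/orP: h => [/andP[_ /E3/D34/D45 -> //]|/R2m].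
      case/or4P=> [/D25 ->|/eqP ->|/eqP ->|/eqP ->] //.
      + by rewrite D45 // mem_head.
      + by rewrite D45 // D34 // E3.
      + by rewrite D5t.
    move=> x xf; have xt : x != t.
      by apply: contraTneq D5t => <-; rewrite df.
    rewrite kx // attf ?D25 // mem_head ph ?addn0 ?addn1 ?ltnS; last first.
      by apply/negbTE/negP => /D25; rewrite df.
    apply: leq_trans (count_adj1 (t := t) (reserve_uniq rE) _) _.
      move=> z zR mz; have : z \in D5 /\ z != s.
        move: zR; rewrite mem_cat mem_filter => /orP[/andP[_ zE]|zR].
          by rewrite D45 ?D34 ?E3 // ne_s // EN.
        rewrite R2s //; split=> //.
        case/or4P: (R2m z zR) => [/D25 ->|/eqP ->|/eqP ->|/eqP ->] //.
          by rewrite D45 // mem_head.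
        by rewrite D45 // D34 // E3.
      case=> zD zs; move: mz; rewrite attf // !inE (negbTE zs) => /eqP.
      by [].
    by case: (M x t).
  (* The revealed edges are [t -> eo], [eh -> s], and those inherited from the old chain. *)
  - move=> x; rewrite !inE => /or3P[/eqP ->|/eqP ->|xK] w cw Nw.
    + exists eo; first by rewrite eoN.
      split; [|exact: teo|by right; exact: forced].
      rewrite !inE !negb_or eoKh neh andbT.
      by apply: contraTneq eo4 => ->; rewrite tnF.
    + exists s; first by rewrite eqxx orbT.
      split; [|exact: forced|by left].
      rewrite !inE ![s == _]eq_sym !ne_s //=.
      by apply/negP => /KNh/sNh; rewrite sN.
    + have [|e eN [eK le es]] := lh x xK w cw; first by move=> a /sNhD/Nw.
      exists e; first by case/orP: eN => [/sNh ->|->]; rewrite ?orbT.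
      split=> //; rewrite !inE !negb_or eK andbT.
      case/orP: eN => [eN|/eqP ->]; last by rewrite ![s == _]eq_sym !ne_s.
      apply/andP; split; first by apply: contraTneq eN => ->; rewrite tNh.
      by apply: contraTneq eN => ->.
have e1D4 : e1 \in D4 by apply/D34/E3.
have e2D4 : e2 \in D4 by rewrite mem_head.
have e21 : e2 != e1 by rewrite (neq _ _ D3) // E3.
have e1D2 := dE1 _ e1E.
have e2D2 : e2 \in D2 = false by apply/negbTE/negP => /D23; rewrite e2F.
case: fork => H.
  apply: (build e2 e1 N2 (N1 ++ D) K2 ps2 tau2) => //; rewrite ?EN 1?eq_sym //.
  - by move=> x; rewrite eND mem_cat => h; rewrite mem_cat D25 ?orbT // !mem_cat;
      case/orP: h => [->//|]; rewrite mem_cat => ->; rewrite orbT.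
  - by apply/negP => /N2D2; rewrite e2D2.
  - by apply/negP => /N2D2; rewrite e1D2.
  - move=> x xN1; rewrite (_ : x \in ps2 = false) //.
    by apply/negbTE/negP => /pK2/KN2/dN2; rewrite mem_cat xN1.
apply: (build e1 e2 N1 D K1 ps1 tau1) => //; rewrite ?EN //.
- move=> x; rewrite eND mem_cat => h; rewrite mem_cat D25 ?orbT // !mem_cat.
  by case/orP: h => ->; rewrite ?orbT.
- by apply/negP => /N1D2; rewrite e1D2.
- by apply/negP => /N1D2; rewrite e2D2.
- move=> x xN2; rewrite (_ : x \in ps1 = false) //.
  by apply/negbTE/negP => /pK1/KN1 xN1; have := dN2 x xN2; rewrite mem_cat xN1.
Qed.

Lemma chain m D : uniq D -> ssuff M D -> {subset Q <= D} ->
  exists N tau K ps, chain_over D m N tau K ps.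
Proof.
elim: m D => [|m IH] D uD sD QD; first exact: chain0 (QD _ sQ).
have [N1 [t1 [K1 [ps1 c1]]]] := IH D uD sD QD.
have [[u1 s1 _ _ _] _ _ _ _] := c1.
have [|N2 [t2 [K2 [ps2 c2]]]] := IH (N1 ++ D) u1 s1.
  by move=> x /QD; rewrite mem_cat orbC => ->.
exact: chainS c1 c2.
Qed.

End Tower.

(** * Attaching a finite set on top of a chain *)

Section Attach.
Variables (V : countType) (M : sgraph V).
Hypothesis HM : fraisse_limit_C1 M.
Implicit Types (c D ps K : seq V).

Lemma attach c D ps : good M c -> uniq D -> ssuff M D -> uniq ps ->
  {subset ps <= D} -> size ps + edges M c = 2 * size c ->
  exists c', [/\ uniq (c' ++ D), ssuff M (c' ++ D), matching M c c',
    {in D, forall d, count (M d) c' <= (d \in ps)} &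
    forall K, uniq K -> {subset ps <= K} -> {subset K <= D} ->
      2 * size c + edges M K <= edges M (c' ++ K)].
Proof.
elim: c ps => [|x c IH] ps /= gc uD sD ups psD sz.
  by exists [::]; split=> // K *; rewrite muln0.
have /and3P[xc cx gc'] := gc.
pose n := 2 - count (M x) c.
have nps : n <= size ps by have := edges_le gc'; rewrite /n; lia.
have ut : uniq (take n ps) := take_uniq n ups.
have ud : uniq (drop n ps) := drop_uniq n ups.
have dis a : a \in take n ps -> a \in drop n ps -> false.
  move=> at_ ad; move: ups; rewrite -(cat_take_drop n ps) cat_uniq.
  by case/and3P=> _ /hasPn /(_ a ad); rewrite /= at_.
have [||c' [uc sc mt cnt ed]] := IH (drop n ps) gc' uD sD ud.
- by move=> a /mem_drop/psD.
- by rewrite size_drop; move: sz nps cx; rewrite /n; lia.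
pose P := mask (map (M x) c) c' ++ take n ps.
have [uc' /hasPn c'D _] := and3P (etrans (esym (cat_uniq _ _)) uc).
have tD a : a \in take n ps -> a \in D by move/mem_take/psD.
have tc a : a \in D -> a \in c' = false by move=> /c'D /negbTE.
have sm : size (map (M x) c) = size c' by rewrite size_map (matching_size mt).
have sP : size P = 2.
  have ec : count id (map (M x) c) = count (M x) c by rewrite count_map.
  by rewrite size_cat size_mask // size_takel // ec /n; move: cx; lia.
have uP : uniq P.
  rewrite cat_uniq mask_uniq // ut andbT /=.
  apply/hasPn => a /tD aD; apply/negP => /mem_mask; by rewrite tc.
have [|v [vn sv adj]] := @ssuff_add1 _ _ HM _ P sc; first by rewrite sP.
exists (v :: c'); split.
- by rewrite /= vn.
- exact: sv.
- split=> //; rewrite -(mask_mem uc' sm); apply/eq_in_map => a ac.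
  rewrite adj ?mem_cat ?ac // [a \in take n ps](_ : _ = false) ?orbF //.
  by apply/negbTE; apply: contraL ac => /tD /tc ->.
- move=> d dD /=.
  have -> : M d v = (d \in take n ps).
    rewrite adj_sym adj ?mem_cat ?dD ?orbT //.
    by case: (boolP (d \in mask _ _)) => // /mem_mask; rewrite tc.
  have := cnt d dD; rewrite -[X in _ -> _ <= (d \in X)](cat_take_drop n ps).
  rewrite mem_cat; have := dis d.
  by case: (d \in take n ps); case: (d \in drop n ps) => // /(_ isT isT).
- move=> K uK psK KD /=.
  have := ed K uK _ KD => /(_ (fun a h => psK a (mem_drop h))).
  suff : 2 <= count (M v) (c' ++ K) by lia.
  rewrite -sP -size_filter; apply: uniq_leq_size => // a aP.
  have a1 : a \in c' ++ K.
    move: aP; rewrite !mem_cat => /orP[/mem_mask ->//|/mem_take/psK ->].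
    by rewrite orbT.
  rewrite mem_filter a1 andbT adj //.
  by move: a1; rewrite !mem_cat => /orP[->|/KD ->]; rewrite ?orbT.
Qed.

End Attach.

(** The depth [n] only affects the ladder below [s], so [l] can be chosen first. A walk down inside
    the copy of [C] and the chain ends in a sink, which edge counting forces into the chain, and
    there [s] is at most two steps away. *)
Lemma tower (V : countType) (M : sgraph V) (y : rel V) (C : seq V) :
  fraisse_limit_C1 M -> (forall x, ~~ y x x) ->
  (forall a b c, y a b -> y b c -> y a c) ->
  (forall a b, a != b -> y a b || y b a) -> ssuff M C ->
  exists l, forall n, exists (g : aut M) (S : seq V), {subset map g C <= S} /\
    forall w, compat M y w -> {subset S <= w} -> forall v, v \in map g C ->
      exists2 s, s \in descents M w v l & s \in S /\ deep M n s.
Proof.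
move=> HM yirr ytr ytot sC; have [c gc ec] := ssuff_good sC.
pose m := 2 * size c - edges M c.
(* At most as many steps as [c' ++ K] has vertices, then two more to [s]. *)
exists (size c + 2 * m).+2 => n.
have [Q [s [p [q [[uQ sQ nQ aQ] [sinQ pQ qQ pq [sp sq]]]]]]] := ladder HM n.
have [N [tau [K [ps [[uN sN sep tN KN] [uK sK pathK _] [ups sps psK]
  [N' eN rN] light]]]]] := chain HM yirr ytr ytot aQ sinQ pQ qQ pq sp sq m uQ sQ
  (fun x xQ => xQ).
set D := N ++ Q in uN sN.
have KD : {subset K <= D} by move=> x /KN xN; rewrite mem_cat xN.
have dNQ x : x \in N -> x \in Q = false.
  move: uN; rewrite cat_uniq => /and3P[_ /hasPn dis _] xN.
  by apply/negbTE; apply: contraL xN => /dis.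
have psD : {subset ps <= D} by move=> x /psK/KD.
have [|c' [uc sc mt cnt ed]] := attach HM gc uN sN ups psD.
  by rewrite sps subnK // edges_le.
have [uc' /hasPn c'D _] := and3P (etrans (esym (cat_uniq _ _)) uc).
have gc' := matching_good gc mt uc'.
have [q0 gq0 eq0] := ssuff_good sQ.
have eD : D =i N' ++ q0 by move=> x; rewrite !mem_cat eN eq0.
have c'dis x : x \in c' -> x \in D = false.
  by move=> xc; apply/negbTE; apply: contraL xc => /c'D.
have gq : good M (q0 ++ c').
  rewrite -reserve0; apply: (reserve_cat (k' := fun=> 0)); rewrite ?reserve0 //.
    rewrite cat_uniq (good_uniq gq0) uc' andbT; apply/hasPn => x xc.
    by rewrite /= eq0; apply/negP => xQ; have := c'dis x xc; rewrite mem_cat xQ orbT.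
  move=> x; rewrite eq0 => xQ; rewrite addn0; apply: leq_trans (cnt x _) _.
    by rewrite mem_cat xQ orbT.
  by case: (boolP (x \in ps)) => // /psK/KN/dNQ; rewrite xQ.
(* The room kept in [N'] allows [c'] to be listed last. Hence [c'] is self-sufficient, and an
   automorphism carries [c] onto it. *)
have gall : good M (N' ++ q0 ++ c').
  rewrite -reserve0; apply: (reserve_cat rN); rewrite ?reserve0 //.
    rewrite cat_uniq (reserve_uniq rN) (good_uniq gq) andbT.
    apply/hasPn => x; rewrite mem_cat eq0 /= eN => /orP[xQ|/c'dis].
      by apply/negP => /dNQ; rewrite xQ.
    by rewrite mem_cat => /negbT; rewrite negb_or => /andP[].
  move=> x; rewrite eN => xN; rewrite addn0 count_cat.
  apply: leq_trans (leq_addr _ _); apply: leq_add.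
    apply: count_adj1 (good_uniq gq0) _ => z; rewrite eq0; exact: sep.
  by apply: cnt; rewrite mem_cat xN.
have sc' : ssuff M c'.
  apply: (@ssuff_suffix _ _ (N' ++ q0)); rewrite -?catA //.
  apply: ssuff_eq sc => x.
  by rewrite [x \in c' ++ D]mem_cat [x \in D]eD !mem_cat orbC orbA.
have [g gE] : exists g : aut M, map g c = c'.
  apply: (ssuff_homogeneous HM) => //; first exact: good_uniq gc.
  by apply: ssuff_eq sC => x; rewrite ec.
have mg v : (v \in map g C) = (v \in c').
  by rewrite -gE; apply/mapP/mapP => -[a ac ->]; exists a; rewrite // ?ec // -ec.
have szc : size c' = size c by rewrite -gE size_map.
exists g, (c' ++ D); split=> [v|w cw Sw v]; rewrite mg => vc.
  by rewrite mem_cat vc.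
have gw : good M w by case: cw.
have uP : uniq (c' ++ K).
  rewrite cat_uniq uc' uK andbT; apply/hasPn => x /KD xD.
  by apply/negP => /c'dis; rewrite xD.
have vP : v \in c' ++ K by rewrite mem_cat vc.
have vS : v \in c' ++ D by rewrite mem_cat vc.
have Dw : {subset D <= w} by move=> x xD; apply: Sw; rewrite mem_cat xD orbT.
have [z zb [zP sink]] := descents_sink M (good_uniq gw) uP (Sw v vS) vP.
have zw : z \in w.
  by move: zP; rewrite mem_cat => /orP[zc|/KD/Dw //]; apply: Sw; rewrite mem_cat zc.
have szP : size (c' ++ K) = size c + 2 * m by rewrite size_cat szc sK.
rewrite szP in zb.
case: (boolP (z \in K)) => zK.
  have [e _ [_ le es]] := light z zK w cw Dw.
  have eb := descents_step zb le.
  exists s; last first.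
    split; first by rewrite !mem_cat sinQ !orbT.
    by move=> X uX sX sinX; apply: leq_trans nQ _; apply: (apex_deep uQ aQ).
  case: es => [<-|es]; last exact: descents_step eb es.
  exact: descents_mono eb.
exfalso; have zc : z \in c' by move: zP; rewrite mem_cat (negbTE zK) orbF.
pose wK := [seq x <- w | x \in c' ++ K].
have pK : perm_eq wK (c' ++ K).
  apply: uniq_perm => //; first exact/filter_uniq/(good_uniq gw).
  move=> x; rewrite mem_filter andb_idr // => xP.
  by move: xP; rewrite mem_cat => /orP[xc|/KD/Dw //]; apply: Sw; rewrite mem_cat xc.
have inwK : wK =i c' ++ K := perm_mem pK.
have cm : count (mem K) wK = count (mem K) c' + 2 * m.
  rewrite (permP pK) count_cat -sK; congr (_ + _).
  by apply/eqP; rewrite -all_count; apply/allP.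
have := @edges_bound _ M wK K z (good_filter _ gw).
rewrite (edges_perm M pK) (perm_size pK) inwK szP cm => bd.
have := ed K uK psK KD; have := edges_sorted pathK; rewrite sK => h1 h2.
(* The path [K] has at least [2m - 1] edges, so [c' ++ K] has at least [2|c| + 2m - 1], one more
   than a sink outside [K] permits. *)
have arith (E e a b d : nat) : 2 * d <= e.+1 -> 2 * a + e <= E ->
    E + (b + 2 * d) + 2 <= 2 * (a + 2 * d) -> False by clear; lia.
apply: arith h1 h2 (bd _ zP zK _).
  (* The revealed edge of [x] leaves [c' ++ K], so at most one out-edge stays inside. *)
  move=> x; rewrite inwK => _ xK; have [e eNs [eK le _]] := light x xK w cw Dw.
  have eP : e \notin c' ++ K.
    rewrite mem_cat negb_or eK andbT; apply/negP => /c'dis.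
    by rewrite mem_cat; case/orP: eNs => [->|/eqP ->]; rewrite ?sinQ ?orbT.
  rewrite -size_filter -ltnS.
  apply: (@good_le2 _ M w x (e :: [seq z0 <- wK | lo M wK x z0])) => //.
    rewrite /= filter_uniq ?andbT; last exact/filter_uniq/(good_uniq gw).
    by rewrite mem_filter inwK (negbTE eP) andbF.
  rewrite /= le /=; apply/allP => a; rewrite mem_filter => /andP[l _].
  exact: lo_filter_sub l.
apply/eqP; rewrite -leqn0 leqNgt -has_count; apply/hasPn => x.
by rewrite inwK => xP; apply: contra (sink x xP) => /lo_filter_sub.
Qed.

(** * The flow of linear orders *)

Lemma nbhs_set_val (T : topologicalType) (A : set T) (x : A) (N : set A) :
  nbhs x N <-> exists2 U, nbhs (set_val x) U & set_val @^-1` U `<=` N.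
Proof.
split=> [|[U]]; rewrite !nbhsE.
  move=> [_ [[U oU <-] xU] UN]; exists U => //.
  by exists U => //; split.
move=> [W [oW xW] WU] UN; exists (set_val @^-1` W).
  by split=> //; exists W.
by apply: subset_trans UN => z /WU.
Qed.

Section Orders.
Variable V : countType.
Implicit Types (B : seq V) (f g : {ptws (V * V) -> bool}).

Definition agree B f g :=
  forall a b, a \in B -> b \in B -> f (a, b) = g (a, b).

(** The candidate neighbourhood filter, with a finite set of vertices standing for the coordinates
    it spans. *)
Definition agree_nbhs f : set_system {ptws (V * V) -> bool} :=
  [set U | exists B, forall g, agree B g f -> U g].

Lemma agree_filter f : Filter (agree_nbhs f).
Proof.
split.
- by exists [::].
- move=> P R [B hB] [B' hB']; exists (B ++ B') => g h; split.
    by apply: hB => a b aB bB; apply: h; rewrite mem_cat ?aB ?bB.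
  by apply: hB' => a b aB bB; apply: h; rewrite mem_cat ?aB ?bB orbT.
- by move=> P R PR [B hB]; exists B => g /hB/PR.
Qed.

Lemma nbhs_agree f (N : set {ptws (V * V) -> bool}) :
  nbhs f N <-> exists B, forall g, agree B g f -> N g.
Proof.
have FF := agree_filter f.
have pw t (N' : set bool) : nbhs (f t) N' -> nbhs f [set g | N' (g t)].
  exact: (@proj_continuous _ (fun=> bool) t f).
split; last first.
  move=> [B hB].
  have fin (l : seq (V * V)) : nbhs f [set g | forall t, t \in l -> g t = f t].
    elim: l => [|t l IH]; first exact: filterS filterT.
    have ft : nbhs (f t) [set b | b = f t] by apply/principal_filterP.
    have /(filterI IH) := pw t _ ft; apply: filterS.
    by move=> g [/= h gt] t'; rewrite inE => /predU1P[->|/h].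
  apply: filterS (fin [seq (a, b) | a <- B, b <- B]) => g /= h; apply: hB.
  by move=> a b aB bB; apply: h; apply/allpairsP; exists (a, b).
suff : agree_nbhs f --> f by move=> /(_ N).
apply/cvg_sup => t; apply/cvg_image.
  by apply/seteqP; split=> // b _; exists (fun=> b).
move=> W nW; rewrite nbhs_simpl; exists [set g : _ -> bool | W (g t)].
  exists [:: t.1; t.2] => g h.
  have /= -> : g t = f t.
    by rewrite (surjective_pairing t); apply: h; rewrite !inE eqxx ?orbT.
  exact: nbhs_singleton nW.
apply/seteqP; split=> [_ [g gW <-] //|b bW]; by exists (fun=> b).
Qed.

Lemma nbhs_LO (y : LO V) (N : set (LO V)) :
  nbhs y N <-> exists B, forall z : LO V, agree B (set_val z) (set_val y) -> N z.
Proof.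
split=> [/nbhs_set_val[U /nbhs_agree[B hB] UN]|[B hB]].
  by exists B => z /hB/UN.
apply/nbhs_set_val; exists [set g | agree B g (set_val y)].
  by apply/nbhs_agree; exists B.
by move=> z /hB.
Qed.

Lemma nbhs_subLO (Y : set (LO V)) (y : Y) (N : set Y) :
  nbhs y N <-> exists B, forall z : Y,
    agree B (set_val (set_val z)) (set_val (set_val y)) -> N z.
Proof.
split=> [/nbhs_set_val[U /nbhs_LO[B hB] UN]|[B hB]].
  by exists B => z /hB/UN.
apply/nbhs_set_val; exists [set g | agree B (set_val g) (set_val (set_val y))].
  by apply/nbhs_LO; exists B.
by move=> z /hB.
Qed.

(** Tychonoff gives a cluster point; the axioms of a linear order involve at most three points at a
    time, so they survive. *)
Lemma LO_cluster (u : nat -> LO V) : exists y : LO V, forall B n,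
  exists m, n <= m /\ agree B (set_val (u m)) (set_val y).
Proof.
have cT : compact [set f : {ptws (V * V) -> bool} | forall i, [set: bool] (f i)].
  exact: (@tychonoff _ (fun _ : V * V => bool) (fun=> setT) (fun=> bool_compact)).
pose F := (fun n => set_val (u n) : {ptws (V * V) -> bool}) @ \oo.
have [|f [_ cf]] := cT F _; first by apply: filterS filterT => g _ i.
have ag B n : exists m, n <= m /\ agree B (set_val (u m)) f.
  have F1 : F [set g | exists m, n <= m /\ set_val (u m) = g].
    by exists n => // m /= nm; exists m.
  have [|g [[m [nm <-]] a]] := cf _ [set g | agree B g f] F1.
    by apply/nbhs_agree; exists B.
  by exists m.
have fLO : f \in LO V.
  apply/mem_set; split.
  - move=> x; have [m [_ a]] := ag [:: x] 0.
    rewrite -a ?mem_head //; have [h _ _] := set_valP (u m); exact: h.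
  - move=> x y z; have [m [_ a]] := ag [:: x; y; z] 0.
    rewrite -!a ?inE ?eqxx ?orbT //; have [_ h _] := set_valP (u m); exact: h.
  - move=> x y; have [m [_ a]] := ag [:: x; y] 0.
    rewrite -!a ?inE ?eqxx ?orbT //; have [_ _ h] := set_valP (u m); exact: h.
by exists (exist _ f fLO).
Qed.

End Orders.

Definition lt_of (V : Type) (r : LO V) : rel V := fun a b => set_val r (a, b).

(** * Recurrence in a minimal subflow *)

Section Flow.
Variables (V : countType) (M : sgraph V) (Y : set (LO V)).
Hypotheses (HM : fraisse_limit_C1 M) (Ymin : minimal_subflow M Y).

(* Minimality makes the pattern of [y0] on [B] recur in every [y] in [Y];
   compactness bounds the region where it does. *)
Lemma syndetic (y0 : LO V) (B : seq V) : Y y0 -> exists2 C : seq V, ssuff M C &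
  forall y, Y y -> exists g : aut M, {subset map g B <= C} /\
    {in B &, forall a b, lt_of y (g a) (g b) = lt_of y0 a b}.
Proof.
move=> Yy0; have [F [F1 F2 _ _]] := HM; have [[_ clY inv] mini] := Ymin.
pose rec y (g : aut M) := {in B &, forall a b, lt_of y (g a) (g b) = lt_of y0 a b}.
apply: contrapT => noC.
have bad n : exists y, Y y /\ forall g : aut M, {subset map g B <= F n} -> ~ rec y g.
  apply: contrapT => no; apply: noC; exists (F n); first exact: chain_ssuff.
  move=> y Yy; apply: contrapT => nog; apply: no; exists y; split=> // g gB rg.
  by apply: nog; exists g.
have [u hu] := choice bad.
have [y cl] := LO_cluster u.
(* The orders without the pattern form a closed invariant set. It contains the cluster point [y], so
   by minimality it is [Y]; but [y0] shows the pattern at the identity. *)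
pose Z := [set z | Y z /\ forall g, ~ rec z g].
have Zy : Z y.
  split.
    apply: clY => N /nbhs_LO[B' hB']; have [m [_ a]] := cl B' 0.
    by exists (u m); split; [have [] := hu m|exact: hB'].
  move=> g rg; have [n _ gn] := chain_covers F1 F2 (map g B) 0.
  have [m [nm a]] := cl (map g B) n; have [_ /(_ g)] := hu m; apply.
    by move=> x /gn; rewrite -(subnKC nm); exact: chain_mono.
  move=> x z xB zB; rewrite -rg // /lt_of; apply: a; exact: map_f.
have subZ : subflow M Z.
  split; first by exists y.
  - move=> z clz; split.
      by apply: clY; apply: closureS clz => x [].
    move=> g rg; have [|x [[_ nx] a]] := clz [set x | agree (map g B) (set_val x) (set_val z)].
      by apply/nbhs_LO; exists (map g B).
    apply: (nx g) => a' b' aB bB; rewrite -rg // /lt_of; apply: a; exact: map_f.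
  - move=> h z [Yz nz]; split; first exact: inv.
    by move=> g rg; apply: (nz (aut_comp (aut_sym h) g)).
have : Z y0 by rewrite (mini Z subZ) // => z [].
by move=> [_ /(_ (aut_id M))]; apply.
Qed.

(** Some translate of [y] has a compatible list of [C], and inside [C] that translate repeats the
    pattern of [y] on [C0], so the list can be restricted and pulled back. *)
Lemma compat_exists y (S : seq V) : Y y ->
  exists2 w, compat M (lt_of y) w & {subset S <= w}.
Proof.
move=> Yy; have [[_ _ inv] _] := Ymin.
have [C0 _ SC0] := ssuff_extend HM S.
have [C sC hC] := syndetic C0 Yy.
have [g [w' [ew cw]]] := compat_copy HM (lt_of y) sC.
have [g1 [gC r1]] := hC _ (inv (aut_sym g) y Yy).
exists (map (aut_inv g1) [seq x <- w' | x \in map g1 C0]).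
  apply: compat_map (compat_filter _ cw).
  - exact: (@aut_inj _ _ (aut_sym g1)).
  - exact: (aut_adj (aut_sym g1)).
  - move=> a b; rewrite !mem_filter => /andP[/mapP[a0 aC ->] _].
    move=> /andP[/mapP[b0 bC ->] _]; rewrite !aut_funK -r1 //.
move=> x /SC0 xC; apply/mapP; exists (g1 x); last by rewrite aut_funK.
by rewrite mem_filter ew gC map_f.
Qed.

End Flow.

(** * Meagreness of the orbits *)

Lemma deep_aut (V : countType) (M : sgraph V) (k : aut M) n s :
  deep M n s -> deep M n (k s).
Proof.
move=> d X uX sX kX; rewrite -(size_map (aut_sym k)); apply: d.
- rewrite map_inj_uniq //; exact: aut_inj.
- exact: ssuff_aut.
- by apply/mapP; exists (k s); rewrite //= aut_funK.
Qed.

Theorem theorem4p1 (V : countType) (M1 : sgraph V) (Y : set (LO V)) :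
  fraisse_limit_C1 M1 ->
  minimal_subflow M1 Y ->
  forall r : LO V, Y r ->
    meagre [set y : Y | flow_orbit M1 r (set_val y)].
Proof.
move=> HM Ymin r Yr; have [[_ _ inv] _] := Ymin.
have [X sX _] := ssuff_extend HM [::].
have [//|a _] := @ssuff_add1 _ _ HM X [::] sX.
(* The orbit is cut into countably many pieces according to the image [v] of the vertex [a]. *)
pose O v := [set y : Y | exists g : aut M1, g a = v /\ act g r = set_val y].
exists (fun n => if @choice.unpickle V n is Some v then O v else set0); last first.
  move=> y /= [g _ gr]; exists (choice.pickle (g a)) => //=.
  by rewrite choice.pickleK; exists g.
move=> n; case: (choice.unpickle n) => [v|]; last first.
  by rewrite /nowhere_dense closure0 interior0.
apply/seteqP; split=> // y0 /nbhs_subLO[B hB]; exfalso.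
(* If [O v] is somewhere dense, every order of [Y] that agrees with [y0] on [B] is approximated by
   translates of [r] taking [a] to [v]. *)
have near (y : LO V) : Y y -> agree B (set_val y) (set_val (set_val y0)) ->
    forall S, exists g : aut M1, g a = v /\ agree S (set_val (act g r)) (set_val y).
  move=> Yy ag S; pose yY : Y := exist _ y (mem_set Yy).
  have [|z [[g [ga gz]] az]] := hB yY ag [set z : Y |
      agree S (set_val (set_val z)) (set_val y)].
    by apply/nbhs_subLO; exists S.
  by exists g; split=> //; rewrite gz.
have Yy0 : Y (set_val y0) := set_valP y0.
have [irr tr tot] := set_valP (set_val y0).
have [C sC hC] := syndetic HM Ymin (v :: B) Yy0.
have [|l hl] := @tower _ _ (lt_of (set_val y0)) C HM irr tr _ sC.
  by move=> b c /eqP bc; apply/orP; exact: tot.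
have reach m : exists S : seq V, forall w, compat M1 (lt_of r) w ->
    {subset S <= w} -> exists2 x, x \in S & x \in descents M1 w a l /\ deep M1 m x.
  have [g [S [gS hS]]] := hl m.
  have [g1 [g1C r1]] := hC _ (inv (aut_sym g) _ Yy0).
  (* [j] carries [v :: B] into [map g C], and the translate of [y0] by its inverse agrees with [y0]
     on [B]. *)
  pose j := aut_comp g g1.
  have [||h [ha hr]] := near (act (aut_sym j) (set_val y0)) _ _ (map (aut_inv j) S).
  - exact: inv.
  - by move=> b c bB cB; apply: r1; rewrite inE ?bB ?cB orbT.
  (* [k] turns [y0] on [S] into [r] on [map k S] and takes [j v] to [a], so what [tower] says of
     [y0] and [j v] holds for [r] and [a]. *)
  pose k := aut_comp (aut_sym h) (aut_sym j).
  have kK : cancel k (aut_sym k) := @aut_funK _ _ k.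
  have Kk : cancel (aut_sym k) k := @aut_invK _ _ k.
  have kr : {in S &, forall b c, lt_of r (k b) (k c) = lt_of (set_val y0) b c}.
    move=> b c bS cS; have := hr _ _ (map_f (aut_inv j) bS) (map_f (aut_inv j) cS).
    rewrite -[RHS]/(lt_of (set_val y0) (j (aut_inv j b)) (j (aut_inv j c))).
    by rewrite !aut_invK.
  exists (map k S) => w cw Sw.
  pose wf := [seq x <- w | x \in map k S].
  have cf : compat M1 (lt_of r) wf := compat_filter _ cw.
  have c' : compat M1 (lt_of (set_val y0)) (map (aut_sym k) wf).
    apply: compat_map cf.
    - exact: aut_inj.
    - exact: aut_adj.
    - move=> b c; rewrite !mem_filter => /andP[/mapP[b0 bS ->] _].
      by move=> /andP[/mapP[c0 cS ->] _]; rewrite !kK kr.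
  have S' : {subset S <= map (aut_sym k) wf}.
    move=> x xS; apply/mapP; exists (k x); last by rewrite kK.
    by rewrite mem_filter map_f // Sw // map_f.
  have vS : j v \in map g C.
    by apply: map_f; apply: g1C; rewrite map_f // mem_head.
  have [s sb [sS sd]] := hS _ c' S' _ vS.
  exists (k s); first exact: map_f.
  split; last exact: deep_aut.
  apply: (@descents_filter _ _ (mem (map k S))).
  have ka : k (j v) = a by rewrite /= !aut_funK -ha aut_funK.
  have -> : [seq x <- w | mem (map k S) x] = map k (map (aut_sym k) wf).
    by rewrite -map_comp [RHS]map_id_in // => x _; exact: Kk.
  rewrite -ka descents_aut; [exact: map_f|exact: aut_inj|exact: aut_adj].
have many N : exists S : seq V, forall w, compat M1 (lt_of r) w ->
    {subset S <= w} -> exists xs, [/\ uniq xs, size xs = N, {subset xs <= S} &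
      {subset xs <= descents M1 w a l}].
  elim: N => [|N [S hS]]; first by exists [::] => w _ _; exists [::].
  have [D sD SD] := ssuff_extend HM S; have [d gd eD] := ssuff_good sD.
  (* A vertex this deep lies outside the self-sufficient set [d], which contains [S] and with it all
     earlier vertices. *)
  have [S1 hS1] := reach (size d).+1.
  exists (S1 ++ S) => w cw Sw.
  have [|xs [uxs sxs xsS xsb]] := hS w cw.
    by move=> x xS; apply: Sw; rewrite mem_cat xS orbT.
  have [|x xS1 [xb xd]] := hS1 w cw.
    by move=> x xS; apply: Sw; rewrite mem_cat xS.
  exists (x :: xs); split=> /=.
  - rewrite uxs andbT; apply/negP => /xsS/SD xD.
    have := xd d (good_uniq gd) _ _; rewrite eD ltnn => /(_ _ xD).
    by move/(_ (ssuff_eq (fun z => esym (eD z)) sD)).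
  - by rewrite sxs.
  - by move=> z; rewrite inE mem_cat => /predU1P[->|/xsS ->]; rewrite ?xS1 ?orbT.
  - by move=> z; rewrite inE => /predU1P[->|/xsb].
(* One vertex more than [l] steps down from [a] can reach. *)
have [S hS] := many (3 ^ l).+1.
have [w cw Sw] := compat_exists HM Ymin S Yr.
have [xs [uxs sxs _ xsb]] := hS w cw Sw.
have gw : good M1 w by case: cw.
have := uniq_leq_size uxs xsb; rewrite sxs leqNgt ltnS.
by rewrite (size_descents a l gw).
Qed.
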